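(* Let $A,B$ be $k$-vector spaces of dimensions $a,b$, and let $M \subset \mathrm{Hom}(A,B)$ be a linear subspace of constant rank $r$ with $\dim M = n+1$, $n\ge 1$. Let $\mathcal{E}_M$ and $E_M$ be respectively the image and the cokernel of the associated morphism $\psi_M : a.\mathcal{O}(-1) \to b.\mathcal{O}$ on $\mathbb{P}^n=\mathbb{P}(M)$. Then $c:=c_1(E_M)\geq 0$, and $\mathcal{E}_M$ is a uniform vector bundle of splitting type $(-1^{c},0^{r-c})$.
   Context: Let $k$ be an algebraically closed field of characteristic zero. A linear subspace $M \subset \mathrm{Hom}(A,B)$ is said to be of (constant) rank $r$ if every nonzero $f\in M$ has rank $r$. $\mathbb{P}(M)$ is the projective space of lines of $M$, and $m.\mathcal{O}(j)$ denotes the direct sum of $m$ copies of $\mathcal{O}(j)$. The morphism $\psi_M : A\otimes \mathcal{O}(-1) \to B\otimes \mathcal{O}$ on $\mathbb{P}(M)$ is defined by $(v,\lambda f)\mapsto \lambda f(v)$; since it has rank $r$ at every point, there is an exact sequence $$0 \to F_M \to a.\mathcal{O}(-1) \xrightarrow{\psi_M} b.\mathcal{O} \to E_M \to 0$$ in which $F_M$, $\mathcal{E}_M=\mathrm{Im}(\psi_M)$ and $E_M$ are vector bundles of ranks $a-r$, $r$, $b-r$. First Chern classes are identified with integers. A rank $r$ vector bundle $\mathcal{G}$ on $\mathbb{P}^n$ is uniform, of splitting type $(a_1,\dots,a_r)$, if $\mathcal{G}|_L \simeq \bigoplus_{i=1}^r \mathcal{O}_L(a_i)$ for every line $L \subset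 \mathbb{P}^n$. The notation $(-1^{c},0^{r-c})$ means that $-1$ occurs $c$ times and $0$ occurs $r-c$ times. *)

(* Defs.v *)
(* Varieties are taken in the classical sense (closed points, Zariski topology),
   which loses nothing over an algebraically closed field. *)
From HB Require Import structures.
From mathcomp Require Import all_boot all_order all_algebra.
From mathcomp Require Import mpoly.
From mathcomp Require Import boolp classical_sets.

Set Implicit Arguments.
Unset Strict Implicit.
Unset Printing Implicit Defensive.

Import GRing.Theory.

Local Open Scope ring_scope.

Section ProjectiveSpace.
Variables (k : closedFieldType) (V : vectType k).

(* The projective space P(V) of lines of V. *)
Definition pspace := {U : {vspace V} | \dim U == 1}.

(* A chosen nonzero vector of the line x. *)
Definition rep (x : pspace) : V := vpick (val x).

Definition form_at (P : {mpoly k[\dim {:V}]}) (x : pspace) : k :=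
  P.@[fun i => coord (vbasis {:V}) i (rep x)].

(* The principal open sets Q <> 0, for Q a form, are a basis of the Zariski
   topology; for homogeneous Q the choice of rep is immaterial here. *)
Definition near_pt (x : pspace) (Phi : pspace -> Prop) : Prop :=
  exists (q : nat) (Q : {mpoly k[\dim {:V}]}),
    [/\ Q \is q.-homog, form_at Q x != 0 &
        forall y, form_at Q y != 0 -> Phi y].

(* The fibre of O(j) at a line x consists of the functions on x \ {0} that are
   homogeneous of degree j, and is identified with k by evaluation at rep x.
   A section of O(j) is thus a function pspace -> k, and it is regular at x when
   it is given near x by a quotient P / Q of forms with deg P - deg Q = j. *)
Definition regular (j : int) (f : pspace -> k) (x : pspace) : Prop :=
  exists (p q : nat) (P Q : {mpoly k[\dim {:V}]}),
    [/\ P \is p.-homog, Q \is q.-homog, p%:Z - q%:Z = j, form_at Q x != 0 &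
        forall y, form_at Q y != 0 -> f y = form_at P y / form_at Q y].

(* A family of vector spaces over P(V), with a notion of regularity at a point
   for its sections.  Local sections are represented by global set-theoretic
   ones: being regular at x only constrains a section near x. *)
Record family := Family {
  fib :> pspace -> vectType k;
  reg : (forall x, fib x) -> pspace -> Prop }.

Definition section (E : family) := forall x, E x.

(* The family with fibres F whose sheaf of regular sections is the O-module
   generated by the local sections satisfying G. *)
Definition generated (F : pspace -> vectType k)
    (G : (forall x, F x) -> pspace -> Prop) : family :=
  @Family F (fun s x =>
    exists (m : nat) (c : 'I_m -> pspace -> k) (t : 'I_m -> forall y, F y),
      (forall i, regular 0 (c i) x /\ G (t i) x) /\
      near_pt x (fun y => s y = \sum_i c i y *: t i y)).

(* Local triviality: near each point there is a frame e of r sections, and the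
   regular sections are those whose coordinates in e are regular functions. *)
Definition vector_bundle (r : nat) (E : family) : Prop :=
  forall x, exists e : 'I_r -> section E, near_pt x (fun y =>
    basis_of {:E y} [seq e i y | i <- enum 'I_r] /\
    forall s : section E, reg s y <->
      exists c : 'I_r -> pspace -> k, (forall i, regular 0 (c i) y) /\
        near_pt y (fun z => s z = \sum_i c i z *: e i z)).

Definition morphism (E F : family) (phi : forall x, 'Hom(E x, F x)) : Prop :=
  forall (s : section E) x, reg s x -> @reg F (fun y => phi y (s y)) x.

Definition isomorphic (E F : family) : Prop :=
  exists (phi : forall x, 'Hom(E x, F x)) (psi : forall x, 'Hom(F x, E x)),
    [/\ morphism phi, morphism psi,
        forall x, cancel (phi x) (psi x) & forall x, cancel (psi x) (phi x)].

(* W (x) O(j) *)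
Definition tensO (W : vectType k) (j : int) : family :=
  @Family (fun=> W) (fun s x =>
    forall l : 'Hom(W, k^o), regular j (fun y => l (s y)) x).

Definition O_ (j : int) : family := tensO k^o j.

(* The direct sum of the O(t_i) *)
Definition sumO (t : seq int) : family :=
  @Family (fun=> 'rV[k]_(size t)) (fun s x =>
    forall i : 'I_(size t), regular t`_i (fun y => s y 0 i) x).

Definition image (E F : family) (phi : forall x, 'Hom(E x, F x)) : family :=
  @generated (fun x => subvs_of (limg (phi x))) (fun t x =>
    exists2 s : section E, reg s x &
      forall y, t y = vsproj (limg (phi y)) (phi y (s y))).

(* The fibre F_x / im(phi_x) is realized as the standard complement of
   im(phi_x) in F_x; the quotient map is the projection along im(phi_x). *)
Definition coker (E F : family) (phi : forall x, 'Hom(E x, F x)) : family :=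
  @generated (fun x => subvs_of (limg (phi x))^C%VS) (fun t x =>
    exists2 s : section F, reg s x &
      forall y, t y = vsproj (limg (phi y))^C%VS
                        (daddv_pi (limg (phi y))^C%VS (limg (phi y)) (s y))).

(* The top exterior power of E.  Its fibre at x is identified with k through the
   generator e_1 /\ ... /\ e_r, for e the standard basis of E x; the wedge
   t_1 /\ ... /\ t_r is then the determinant of the t_i in the basis e. *)
Definition det_family (E : family) : family :=
  @generated (fun=> k^o) (fun d x =>
    exists2 t : nat -> section E, (forall i, reg (t i) x) &
      forall y, d y =
        \det (\matrix_(i, j < \dim {:E y}) coord (vbasis {:E y}) j (t i y))).

(* The first Chern class as an integer: c_1(E) = c_1(det E) and c_1(O(d)) = d.
   The default value is irrelevant for vector bundles, as every line bundle on
   P(V) is some O(d). *)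
Definition c1 (E : family) : int :=
  xget 0 [set d : int | isomorphic (det_family E) (O_ d)].

End ProjectiveSpace.

Section Restriction.
Variables (k : closedFieldType) (V : vectType k) (W : {vspace V}).

Fact pspace_incl_subproof (x : pspace (subvs_of W)) :
  \dim (linfun (vsval : subvs_of W -> V) @: val x)%VS == 1.
Proof.
rewrite limg_dim_eq ?(eqP (valP x)) //.
suff /eqP-> : lker (linfun (vsval : subvs_of W -> V)) == 0%VS by rewrite capv0.
by apply/lker0P => u v; rewrite !lfunE; apply: val_inj.
Qed.

(* The inclusion of P(W) into P(V) *)
Definition pspace_incl (x : pspace (subvs_of W)) : pspace V :=
  Sub (linfun (vsval : subvs_of W -> V) @: val x)%VS (pspace_incl_subproof x).

Definition restriction (E : family V) : family (subvs_of W) :=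
  @generated k (subvs_of W) (fun x => E (pspace_incl x)) (fun t x =>
    exists2 s : section E, reg s (pspace_incl x) &
      forall y, t y = s (pspace_incl y)).

End Restriction.

Definition uniform (k : closedFieldType) (V : vectType k) (E : family V)
    (t : seq int) : Prop :=
  vector_bundle (size t) E /\
  forall L : {vspace V}, \dim L = 2 ->
    isomorphic (restriction L E) (sumO (subvs_of L) t).

Section Spaces.
Variables (k : closedFieldType) (A B : vectType k) (M : {vspace 'Hom(A, B)}).

Definition constant_rank (r : nat) : Prop :=
  forall f, f \in M -> f != 0 -> \dim (limg f) = r.

(* The morphism A (x) O(-1) -> B (x) O, (v, lambda f) |-> lambda f(v).
   O(-1) is the tautological line bundle: the vector w of the line x corresponds
   to the function v |-> w / v of degree -1 on x \ {0}, so that the fibre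
   coordinate lambda of O(-1) at x stands for the vector lambda * rep x of x. *)
Definition psi (x : pspace (subvs_of M)) :
    'Hom(tensO (subvs_of M) A (-1) x, tensO (subvs_of M) B 0 x) :=
  vsval (rep x).

Definition image_bundle : family (subvs_of M) := image psi.
Definition coker_bundle : family (subvs_of M) := coker psi.

End Spaces.

(* Main.v *)
(* Fix a basis a_i of A and b_j of B.  For a set I of r of the a_i and a set J
   of b - r of the b_j, the determinant N_IJ(f) of the vectors f(a_i), i in I,
   and b_j, j in J, is a form of degree r on M.  Since f has rank r everywhere,
   (N_IJ) has rank one at every point, and as polynomial rings have gcds, N_IJ =
   u_I w_J with u_I, w_J forms of degrees r - d and d.  The w_J have no common
   zero and represent the map from the exterior power of B to det E_M, so that
   det E_M = O(d), where 0 <= d <= r.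

   Let L be a line of P(M), let B' be the intersection of the images of all f in
   L, and let A' be a complement of f^-1(B'), which does not depend on f: if
   f(v) is in B', then g(v) is in im(f + t g) for all t <> 0, hence also for
   t = 0 because the rank is constant.  So im f is the direct sum of f(A') and
   B', and the restriction to L is A' (x) O(-1) + B' (x) O.  The determinants of
   the frame f(a'_i), b'_i and of the b_j, j in J, have degree dim A' and are
   proportional to the w_J by a function without zeros or poles on L, which
   forces dim A' = d. *)

Require Import Defs.
From HB Require Import structures.
From mathcomp Require Import all_boot all_order all_algebra.
From mathcomp Require Import perm mpoly boolp classical_sets zify ring.

Set Implicit Arguments.
Unset Strict Implicit.
Unset Printing Implicit Defensive.

Import GRing.Theory.

Local Open Scope ring_scope.

(** The fibres carry no continuous bases: [rep], the complement that models the cokernel and the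
    basis of that complement are arbitrary choices at every point. The minors of the quotient map in
    these bases are meaningful only up to a common factor at each point, and the w_J serve as
    polynomial representatives of their ratios. The wild factor [nu] between the two does no harm:
    up to inversion it is itself the isomorphism between det E_M and O(d). That the w_J have no
    common zero is the surjectivity of the quotient map.

    One fact fixes all degrees: on a projective space of positive dimension, a regular function of
    degree e without zeros has e = 0. It makes c_1 well defined and, applied on L, gives dim A' = d.

    Gcds of polynomials come from Gauss's lemma over a gcd domain, without factorization into
    irreducibles. I and J run over all maps instead of subsets: repetitions only add zero minors,
    and ordered subsets are avoided. *)

Definition divides (S : idomainType) (a b : S) := exists c, b = c * a.

Definition is_gcd (S : idomainType) (s : seq S) g :=
  (forall x, x \in s -> divides g x) /\
  forall d, (forall x, x \in s -> divides d x) -> divides d g.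

Definition gcd_domain (S : idomainType) := forall a b : S, exists g, is_gcd [:: a; b] g.

(** * Polynomial rings are gcd domains *)

Section GcdDomain.
Variable R : idomainType.
Implicit Types (a b c d g : R) (s : seq R) (p q : {poly R}).

Lemma dividesxx a : divides a a. Proof. by exists 1; rewrite mul1r. Qed.

Lemma divides0 a : divides a 0. Proof. by exists 0; rewrite mul0r. Qed.

Lemma divides_trans b a c : divides a b -> divides b c -> divides a c.
Proof. by move=> [x ->] [y ->]; exists (y * x); rewrite mulrA. Qed.

Lemma divides_mull c a b : divides a b -> divides a (c * b).
Proof. by case=> x ->; exists (c * x); rewrite mulrA. Qed.

Lemma divides_add a b c : divides a b -> divides a c -> divides a (b + c).
Proof. by move=> [x ->] [y ->]; exists (x + y); rewrite mulrDl. Qed.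

Lemma divides_mul2l c a b : divides a b -> divides (c * a) (c * b).
Proof. by case=> x ->; exists x; rewrite mulrCA. Qed.

Lemma divides_cancel c a b : c != 0 -> divides (c * a) (c * b) -> divides a b.
Proof.
by move=> c0 [x e]; exists x; apply: (mulfI c0); rewrite e mulrCA.
Qed.

Hypothesis gcdR : gcd_domain R.

Lemma gcd_exists s : exists g, is_gcd s g.
Proof.
elim: s => [|a s [g [gs gmax]]]; first by exists 0; split=> // d _; apply: divides0.
have [h [hg hmax]] := gcdR a g; exists h; split=> [x|d dx].
  rewrite inE => /predU1P[->|xs]; first by apply: hg; rewrite mem_head.
  by apply: (divides_trans _ (gs x xs)); apply: hg; rewrite !inE eqxx orbT.
apply: hmax => x; rewrite !inE => /orP[|] /eqP->; first by apply: dx; rewrite mem_head.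
by apply: gmax => y ys; apply: dx; rewrite inE ys orbT.
Qed.

(** For maximality, take a gcd e of the products c x: c divides all of them, hence e, and the
    quotient e / c divides every x, hence g. *)
Lemma is_gcd_mul c s g : is_gcd s g -> is_gcd [seq c * x | x <- s] (c * g).
Proof.
move=> [gs gmax]; split=> [_ /mapP[x xs ->]|d dx]; first exact/divides_mul2l/gs.
have [->|c0] := eqVneq c 0; first by rewrite mul0r; apply: divides0.
have [e [es emax]] := gcd_exists [seq c * x | x <- s].
have [|e' ee'] := emax c; first by move=> _ /mapP[x _ ->]; exists x; rewrite mulrC.
apply: divides_trans (emax _ dx) _; rewrite ee' mulrC; apply/divides_mul2l/gmax => x xs.
by apply: (divides_cancel c0); rewrite [c * e']mulrC -ee'; apply/es/map_f.
Qed.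

(** Euclid's lemma: c is a gcd of the products c y. *)
Lemma gcd_coprime_mul c s x : is_gcd s 1 ->
  (forall y, y \in s -> divides x (c * y)) -> divides x c.
Proof.
move=> /(is_gcd_mul c)[_ cmax] xs; rewrite -[c]mulr1; apply: cmax.
by move=> _ /mapP[y ys ->]; apply: xs.
Qed.

Lemma is_gcd1P s : is_gcd s 1 <-> forall d, (forall x, x \in s -> divides d x) ->
  divides d 1.
Proof. by split=> [[]|h] //; split=> // x _; exists x; rewrite mulr1. Qed.

Definition primitive p := is_gcd p 1.

Lemma divides_coef d p : (forall x, x \in (p : seq R) -> divides d x) <->
  forall i, divides d p`_i.
Proof.
split=> [h i|h x /(nthP 0)[i _ <-]] //.
have [/(nth_default 0)->|] := leqP (size p) i; first exact: divides0.
by move=> /(mem_nth 0)/h.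
Qed.

Lemma divides_polyC d p : divides d%:P p <-> forall i, divides d p`_i.
Proof.
split=> [[q ->] i|h]; first by rewrite coefMC; exists q`_i.
have [F Fp] : exists F : nat -> R, forall i, (i < size p)%N -> p`_i = F i * d.
  elim: (size p) => [|n [F Fp]]; first by exists (fun=> 0).
  have [c pc] := h n; exists (fun i => if i == n then c else F i) => i.
  by rewrite ltnS leq_eqVlt; case: eqP => [-> _|_ /Fp].
exists (\poly_(i < size p) F i); apply/polyP=> i; rewrite coefMC coef_poly.
by case: ltnP => [/Fp//|/(nth_default 0)->]; rewrite mul0r.
Qed.

Lemma primitive1 : primitive 1.
Proof.
by apply/is_gcd1P => d; rewrite polyseq1 => /(_ 1); apply; rewrite mem_head.
Qed.

Lemma primitive_neq0 p : primitive p -> p != 0.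
Proof.
move=> [_ pm]; apply/eqP => p0; have [|c /eqP] := pm 0; first by rewrite p0 polyseq0.
by rewrite mulr0 oner_eq0.
Qed.

(** Content and primitive part, determined up to units. Cancelling a gcd of the coefficients leaves
    only units as common divisors; the zero polynomial gets content 0 and primitive part 1. *)
Lemma content_decomposition p : exists e p1,
  [/\ p = e *: p1, primitive p1 & is_gcd p e].
Proof.
have [->|p0] := eqVneq p 0.
  exists 0, 1; split; rewrite ?scale0r//; first exact: primitive1.
  by split=> [x|d _]; [rewrite polyseq0 | apply: divides0].
have [e [ep emax]] := gcd_exists p;
  have [p1 pe] := (divides_polyC e p).2 ((divides_coef _ _).1 ep).
have e0 : e != 0 by apply: contraNneq p0 => e0; rewrite pe e0 polyC0 mulr0.
exists e, p1; split; [by rewrite pe mulrC mul_polyC | | by split].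
apply/is_gcd1P => d /divides_coef dp1; apply: (@divides_cancel e) => //; rewrite mulr1.
apply: emax; apply/divides_coef => i; rewrite pe coefMC [_ * e]mulrC.
exact: divides_mul2l.
Qed.

Lemma divides_scaled_primitive d e p : primitive p ->
  (forall i, divides d (e *: p)`_i) -> divides d e.
Proof.
move=> pp dp; apply: (gcd_coprime_mul pp) => _ /(nthP 0)[i _ <-].
by rewrite -coefZ.
Qed.

(* d divides the leading coefficient of p, so it divides every coefficient of
   p' q, where p' is p without its leading term, and p' is shorter than p. *)
Let gauss_lead p q : primitive p ->
  (forall p1, (size p1 < size p)%N -> primitive p1 -> primitive (p1 * q)) ->
  forall c, (forall i, divides c (p * q)`_i) ->
  forall d, divides d c -> divides d (lead_coef p) -> divides d 1.
Proof.
move=> pp IH c cpq d dc dl; set p' := p - lead_coef p *: 'X^((size p).-1).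
have szp' : (size p' < size p)%N.
  have p0 := primitive_neq0 pp; rewrite -(prednK (n := size p)) ?size_poly_gt0// ltnS.
  apply/leq_sizeP => j; rewrite leq_eqVlt => /predU1P[<-|lt].
    by rewrite coefB coefZ coefXn eqxx mulr1 -lead_coefE subrr.
  rewrite coefB coefZ coefXn gtn_eqF// mulr0 subr0 nth_default//.
  by rewrite -(prednK (n := size p)) ?size_poly_gt0.
have [e [p1 [ep p1p [pe _]]]] := content_decomposition p'.
suff de : divides d e.
  apply: pp.2; apply/divides_coef => i.
  rewrite -(subrK (lead_coef p *: 'X^((size p).-1)) p) -/p' coefD; apply: divides_add.
    by apply: (divides_trans de); move: i; apply/divides_coef.
  by rewrite coefZ mulrC; apply: divides_mull.
have [e0|e0] := eqVneq e 0; first by rewrite e0; apply: divides0.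
have p1lt : (size p1 < size p)%N by rewrite -(size_scale p1 e0) -ep.
apply: (divides_scaled_primitive (IH _ p1lt p1p)) => i.
have -> : e *: (p1 * q) = p * q + (- lead_coef p)%:P * ('X^((size p).-1) * q).
  by rewrite scalerAl -ep mulrBl -scalerAl -scaleNr mul_polyC.
rewrite coefD; apply: divides_add; first exact: divides_trans (cpq i).
rewrite coefCM mulrC; apply: divides_mull; case: dl => x ->; exists (- x).
by rewrite mulNr.
Qed.

(** Gauss's lemma, by induction on the sum of the sizes. A common divisor c of the coefficients of p
    q divides the product of the leading coefficients. By [gauss_lead] it is coprime to that of p,
    so it divides that of q, and [gauss_lead] for q makes it a unit. *)
Lemma primitiveM p q : primitive p -> primitive q -> primitive (p * q).
Proof.
have [n] := ubnP (size p + size q); elim: n => // n IH in p q *.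
rewrite ltnS => szn pp pq; apply/is_gcd1P => c /divides_coef cpq.
have Hp := gauss_lead pp _ cpq; have Hq := @gauss_lead q p pq _ c.
have {}Hp d : divides d c -> divides d (lead_coef p) -> divides d 1.
  apply: Hp => p1 lt p1p; apply: IH => //; apply: leq_trans szn.
  by rewrite ltn_add2r.
have {}Hq d : divides d c -> divides d (lead_coef q) -> divides d 1.
  apply: Hq => [q1 lt q1q|i]; last by rewrite mulrC.
  by apply: IH => //; apply: leq_trans szn; rewrite addnC ltn_add2l.
apply: Hq (dividesxx c) _.
apply: (@gcd_coprime_mul _ [:: c; lead_coef p]).
  apply/is_gcd1P => d dx; apply: Hp; apply: dx; rewrite !inE eqxx ?orbT//.
move=> y; rewrite !inE => /orP[|] /eqP->; first exact/divides_mull/dividesxx.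
by rewrite mulrC -lead_coefM lead_coefE.
Qed.

(** The relation [%|] is divisibility over the fraction field: c q = s p for some constant c != 0.
    By Gauss's lemma c divides the content of s, and cancels. *)
Lemma primitive_dvdp p q : primitive p -> p %| q -> divides p q.
Proof.
move=> pp; have [->|q0] := eqVneq q 0; first by move=> _; exists 0; rewrite mul0r.
case/Pdiv.Idomain.dvdpP=> -[c s] /= c0 eq.
have [e [s1 [es s1p _]]] := content_decomposition s.
have [e' ee'] : divides c e.
  apply: (divides_scaled_primitive (primitiveM s1p pp)); apply/divides_polyC.
  by rewrite scalerAl -es -eq; exists q; rewrite mulrC mul_polyC.
exists (e' *: s1); apply: (mulfI (x := c%:P)); first by rewrite polyC_eq0.
by rewrite !mul_polyC eq es ee' -!scalerAl scalerA mulrC.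
Qed.

(** The gcd is c h, for c a gcd of the contents and h the primitive part of the gcd over the
    fraction field. The content of a common divisor divides c and its primitive part divides h. *)
Lemma gcd_domain_poly : gcd_domain {poly R}.
Proof.
move=> p q; have [->|q0] := eqVneq q 0.
  exists p; split=> [x|d dx]; last by apply: dx; rewrite mem_head.
  by rewrite !inE => /orP[|] /eqP->; [exists 1; rewrite mul1r | exists 0; rewrite mul0r].
have h0 : gcdp p q != 0 by rewrite Pdiv.Idomain.gcdp_eq0 negb_and q0 orbT.
have [e [h [he hp _]]] := content_decomposition (gcdp p q).
have e0 : e != 0 by apply: contraNneq h0 => e0; rewrite he e0 scale0r.
have [cp [p1 [pc p1p cpg]]] := content_decomposition p.
have [cq [q1 [qc q1p cqg]]] := content_decomposition q.
have [c [cd cmax]] := gcdR cp cq.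
have aux cr r1 : divides c cr -> gcdp p q %| cr *: r1 -> divides (c%:P * h) (cr *: r1).
  have [->|cr0] := eqVneq cr 0; first by rewrite scale0r; exists 0; rewrite mul0r.
  rewrite Pdiv.Idomain.dvdpZr// he Pdiv.Idomain.dvdpZl// =>
    -[x ->] /(primitive_dvdp hp)[y ->].
  by exists (x%:P * y); rewrite -mul_polyC polyCM -!mulrA; congr (_ * _); rewrite mulrCA.
exists (c%:P * h); split=> [x|d dx].
  rewrite !inE => /orP[|] /eqP->; [rewrite pc | rewrite qc]; apply: aux.
  - by apply: cd; rewrite mem_head.
  - by rewrite -pc Pdiv.Idomain.dvdp_gcdl.
  - by apply: cd; rewrite !inE eqxx orbT.
  - by rewrite -qc Pdiv.Idomain.dvdp_gcdr.
have [cd' [d1 [dc d1p _]]] := content_decomposition d.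
have d0 : cd' != 0.
  apply: contraNneq q0 => d0; have [|y ->] := dx q; first by rewrite !inE eqxx orbT.
  by rewrite dc d0 scale0r mulr0.
have dp : divides d p by apply: dx; rewrite mem_head.
have dq : divides d q by apply: dx; rewrite !inE eqxx orbT.
have dvd x : divides d x -> d1 %| x.
  by move=> [y ->]; rewrite dc; apply: Pdiv.Idomain.dvdp_mull;
    rewrite Pdiv.Idomain.dvdpZr ?Pdiv.Idomain.dvdpp.
have cdx x g : divides d x -> is_gcd x g -> divides cd' g.
  move=> [y ->] [_ +]; apply; apply/divides_coef/divides_polyC; exists (y * d1).
  by rewrite dc -mul_polyC mulrCA [RHS]mulrC.
have [z ->] : divides d1 h.
  by apply: primitive_dvdp => //;
    rewrite -(Pdiv.Idomain.dvdpZr _ _ e0) -he Pdiv.Idomain.dvdp_gcd !dvd.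
have [y ->] : divides cd' c.
  by apply: cmax => x; rewrite !inE => /orP[|] /eqP->; [apply: cdx cpg | apply: cdx cqg].
by exists (y%:P * z); rewrite dc -mul_polyC polyCM mulrACA.
Qed.

End GcdDomain.

(** * Polynomials in n + 1 variables as polynomials in the last variable *)

Section MpolyUniIso.
Variables (R : idomainType) (n : nat).

Definition poly_mpoly (p : {poly {mpoly R[n]}}) : {mpoly R[n.+1]} :=
  (map_poly (@mwiden n R) p).['X_ord_max].

HB.instance Definition _ := GRing.RMorphism.copy poly_mpoly
  (horner_eval ('X_ord_max : {mpoly R[n.+1]}) \o map_poly (@mwiden n R)).

Lemma poly_mpolyC c : poly_mpoly c%:P = mwiden c.
Proof. by rewrite /poly_mpoly map_polyC hornerC. Qed.

Lemma poly_mpolyX : poly_mpoly 'X = 'X_ord_max.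
Proof. by rewrite /poly_mpoly map_polyX hornerX. Qed.

Lemma muni_max : muni ('X_ord_max : {mpoly R[n.+1]}) = 'X.
Proof.
rewrite /muni mmapX mmap1U.
by case: splitP => // j /= e; have := ltn_ord j; rewrite -e ltnn.
Qed.

Lemma muni_widen (i : 'I_n) : muni ('X_(widen_ord (leqnSn n) i) : {mpoly R[n.+1]}) =
  ('X_i)%:P.
Proof.
rewrite /muni mmapX mmap1U.
case: splitP => [j /= e|j /=]; first by congr ('X__)%:P; apply: val_inj.
by rewrite ord1 addn0 => e; have := ltn_ord i; rewrite e ltnn.
Qed.

Lemma mwidenXU (i : 'I_n) : mwiden ('X_i : {mpoly R[n]}) = 'X_(widen_ord (leqnSn n) i).
Proof. by rewrite mwidenX mnmwiden1. Qed.

Lemma muni_mwiden (p : {mpoly R[n]}) : muni (mwiden p) = p%:P.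
Proof.
elim/mpolyind: p => [|c m p _ _ IH]; first by rewrite !rmorph0.
rewrite !rmorphD /= IH mwidenZ muniZ -mul_polyC -mul_mpolyC polyCM; congr (_ * _ + _).
rewrite mpolyXE_id !rmorph_prod /=; apply: eq_bigr => i _.
by rewrite !rmorphXn /= mwidenXU muni_widen.
Qed.

Lemma poly_mpolyD : {morph poly_mpoly : p q / p + q}.
Proof. exact: rmorphD. Qed.

Lemma poly_mpolyM : {morph poly_mpoly : p q / p * q}.
Proof. exact: rmorphM. Qed.

Lemma poly_mpoly0 : poly_mpoly 0 = 0.
Proof. exact: rmorph0. Qed.

Lemma poly_mpoly1 : poly_mpoly 1 = 1.
Proof. exact: rmorph1. Qed.

Lemma muniK : cancel (@muni n R) poly_mpoly.
Proof.
move=> p; elim/mpolyind: p => [|c m p _ _ IH]; first by rewrite muni0 poly_mpoly0.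
rewrite muniD poly_mpolyD [X in _ + X]IH muniZ -[_ *: muni _]mul_polyC.
rewrite poly_mpolyM poly_mpolyC mwidenC -mul_mpolyC.
congr (_ * _ + _); rewrite mpolyXE_id (big_morph _ (@muniM n R) (@muni1 n R)).
rewrite (big_morph _ poly_mpolyM poly_mpoly1); apply: eq_bigr => i _.
elim: (m i) => [|j IHj]; first by rewrite !expr0 muni1 poly_mpoly1.
rewrite !exprS muniM poly_mpolyM [X in _ * X]IHj; congr (_ * _).
have [lt|] := ltnP i n.
  have -> : i = widen_ord (leqnSn n) (Ordinal lt) by apply: val_inj.
  by rewrite muni_widen poly_mpolyC mwidenXU.
move=> le; have -> : i = ord_max by apply: val_inj; apply/eqP;
  rewrite eqn_leq le -ltnS ltn_ord.
by rewrite muni_max poly_mpolyX.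
Qed.

Lemma poly_mpolyK : cancel poly_mpoly (@muni n R).
Proof.
elim/poly_ind => [|p c IH]; first by rewrite poly_mpoly0 muni0.
by rewrite poly_mpolyD poly_mpolyM muniD muniM [X in X * _]IH poly_mpolyX poly_mpolyC
  muni_mwiden muni_max.
Qed.

Lemma meval_poly_mpoly (v : 'I_n.+1 -> R) p :
  (poly_mpoly p).@[v] = (map_poly (meval (fun i =>
    v (widen_ord (leqnSn n) i))) p).[v ord_max].
Proof.
elim/poly_ind: p => [|p c IH]; first by rewrite poly_mpoly0 meval0 rmorph0 horner0.
rewrite poly_mpolyD poly_mpolyM mevalD mevalM [X in X * _]IH poly_mpolyX poly_mpolyC.
rewrite rmorphD rmorphM /= map_polyX map_polyC /= mevalXU !hornerE; congr (_ + _).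
elim/mpolyind: c => [|c m q _ _ IHc]; first by rewrite !rmorph0.
rewrite !rmorphD /= IHc mwidenZ !mevalZ; congr (_ * _ + _).
rewrite mpolyXE_id !rmorph_prod /=; apply: eq_bigr => i _.
by rewrite !rmorphXn /= mwidenXU !mevalXU.
Qed.

End MpolyUniIso.

Lemma horner_avoid (k : closedFieldType) (p : {poly k}) (s : seq k) :
  p != 0 -> exists2 x, x \notin s & p.[x] != 0.
Proof.
move=> p0; have /closed_nonrootP[x] : p * \prod_(a <- s) ('X - a%:P) != 0.
  by rewrite mulf_neq0// monic_neq0// monic_prod_XsubC.
by rewrite rootM root_prod_XsubC negb_or => /andP[px xs]; exists x.
Qed.

Lemma horner_eq0 (k : closedFieldType) (p : {poly k}) : (forall x, p.[x] = 0) -> p = 0.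
Proof.
move=> h; apply/eqP/negPn/negP => /(horner_avoid [::])[x _].
by rewrite h eqxx.
Qed.

(** A closed field is infinite, which settles one variable; the coefficients with respect to the
    last variable then vanish by induction. *)
Lemma meval_eq0 (k : closedFieldType) n (p : {mpoly k[n]}) : (forall v, p.@[v] = 0) ->
  p = 0.
Proof.
elim: n p => [|n IH] p p0.
  suff p00 : p@_0%MM = 0 by rewrite -(mpolyKC p) p00 mpolyC0.
  by rewrite -(@mevalC 0 k (fun=> 0) p@_0%MM) mpolyKC.
rewrite -(muniK p); suff -> : muni p = 0 by rewrite rmorph0.
apply/polyP => i; rewrite coef0; apply: IH => v.
have : map_poly (meval v) (muni p) = 0.
  apply: horner_eq0 => x; pose v' (j : 'I_n.+1) :=
    if unlift ord_max j is Some j' then v j' else x.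
  rewrite -(p0 v') -{2}(muniK p) meval_poly_mpoly /v' unlift_none.
  congr _.[_]; apply: eq_map_poly => q; apply: meval_eq => j.
  have -> : widen_ord (leqnSn n) j = lift ord_max j by apply: val_inj;
    rewrite /= /bump leqNgt ltn_ord.
  by rewrite liftK.
by move=> /polyP/(_ i); rewrite coef_map coef0.
Qed.

Lemma gcd_domain_iso (R S : idomainType) (f : {rmorphism R -> S}) (g : {rmorphism S -> R}) :
  cancel g f -> cancel f g -> gcd_domain R -> gcd_domain S.
Proof.
move=> gK fK gR a b; have [h [hg hmax]] := gR (g a) (g b).
have divf x y : divides x y -> divides (f x) (f y) by move=> [c ->]; exists (f c);
  rewrite rmorphM.
have divg x y : divides x y -> divides (g x) (g y) by move=> [c ->]; exists (g c);
  rewrite rmorphM.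
exists (f h); split=> [x xs|d dx].
  by rewrite -(gK x); apply/divf/hg; move: xs; rewrite !inE => /orP[|] /eqP->;
    rewrite eqxx ?orbT.
rewrite -(gK d); apply/divf/hmax => x; rewrite !inE => /orP[|] /eqP->; apply/divg/dx;
  by rewrite !inE eqxx ?orbT.
Qed.

Lemma gcd_domain_mpoly (k : closedFieldType) n : gcd_domain {mpoly k[n]}.
Proof.
elim: n => [|n IH].
  (* Without variables every polynomial is a constant, so a nonzero one divides everything. *)
  move=> a b; have dv (x y : {mpoly k[0]}) : x != 0 -> divides x y.
    move=> x0; exists ((y@_0%MM / x@_0%MM)%:MP);
      rewrite -{2}(mpolyKC x) -mpolyCM divfK ?mpolyKC//.
    by apply: contraNneq x0 => x0; rewrite -(mpolyKC x) x0 mpolyC0.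
  have [->|a0] := eqVneq a 0; last first.
    exists a; split=> [x _|d]; first exact: dv.
    by apply; rewrite mem_head.
  exists b; split=> [x|d]; last by apply; rewrite !inE eqxx orbT.
  by rewrite !inE => /orP[|] /eqP->; [apply: divides0 | apply: dividesxx].
exact: gcd_domain_iso (@muniK k n) (@poly_mpolyK k n) (gcd_domain_poly IH).
Qed.

(** * Factorization of matrices of rank one *)

(** Dividing row [i0] by a gcd of its entries gives a coprime family w. Every row is proportional to
    w, and w_j0 divides N i j0 * w_j for all j, hence divides N i j0 by coprimality; the quotient is
    u_i. *)
Lemma rank1_factorization (R : idomainType) (I J : finType) (N : I -> J ->
  R) (i0 : I) (j0 : J) :
  gcd_domain R -> N i0 j0 != 0 ->
  (forall i i' j j', N i j * N i' j' = N i j' * N i' j) ->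
  exists u w, forall i j, N i j = u i * w j.
Proof.
move=> gcdR N0 rk1; have [g gg] := gcd_exists gcdR [seq N i0 j | j <- enum J].
have /choice[w Nw] : forall j, exists w, N i0 j = w * g.
  by move=> j; apply: gg.1; apply: map_f; rewrite mem_enum.
have g0 : g != 0 by apply: contraNneq N0 => g0; rewrite Nw g0 mulr0.
have w0 : w j0 != 0 by apply: contraNneq N0 => w0; rewrite Nw w0 mul0r.
have w1 : is_gcd [seq w j | j <- enum J] 1.
  apply/is_gcd1P => d dw; apply: (divides_cancel g0); rewrite mulr1; apply: gg.2.
  move=> _ /mapP[j _ ->]; rewrite Nw [w j * g]mulrC; apply: divides_mul2l; apply: dw.
  by apply: map_f; rewrite mem_enum.
have wN i j j' : w j * N i j' = w j' * N i j.
  by apply: (mulIf g0); rewrite mulrAC -Nw rk1 Nw mulrAC.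
have /choice[u Nu] : forall i, exists u, N i j0 = u * w j0.
  move=> i; apply: (gcd_coprime_mul gcdR w1) => _ /mapP[j _ ->].
  by exists (N i j); rewrite mulrC wN mulrC.
by exists u, w => i j; apply: (mulfI w0); rewrite wN Nu mulrA mulrC [w j * _]mulrC.
Qed.

Section HomogFactor.
Variables (R : idomainType) (n : nat).
Implicit Types p q : {mpoly R[n]}.
Local Notation homc := (pihomog mdeg).

(** Components below e and d vanish, and every remaining pair other than (e, d) has a larger total
    degree. *)
Lemma pihomog_lowM p q e d : (forall a, (a < e)%N -> homc a p = 0) ->
  (forall b, (b < d)%N -> homc b q = 0) -> homc (e + d)%N (p * q) = homc e p * homc d q.
Proof.
(* A common truncation bound, large enough for e and d to index summands of the two partitions. *)
move=> pe qd; set k := (msize p + msize q + e + d).+1.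
have ek : (e < k)%N by rewrite ltnS -addnA addnCA leq_addr.
have dk : (d < k)%N by rewrite ltnS leq_addl.
have eqp : p = \sum_(a < k) homc a p by apply: pihomog_partitionE;
  rewrite /k -!addnA -addnS leq_addr.
have eqq : q = \sum_(a < k) homc a q.
  by apply: pihomog_partitionE; rewrite /k [(_ p + _)%N]addnC -!addnA -addnS leq_addr.
rewrite {1}eqp {1}eqq mulr_suml raddf_sum /=.
have main (a b : nat) : homc (e + d)%N (homc a p * homc b q) =
    if (a == e) && (b == d) then homc e p * homc d q else 0.
  have [ae|ea] := ltnP a e; first by rewrite pe// mul0r pihomog0 ltn_eqF.
  have [bd|db] := ltnP b d; first by rewrite qd// mulr0 pihomog0 (ltn_eqF bd) andbF.
  have hom : homc a p * homc b q \is (a + b).-homog by apply: dhomogM; apply: pihomogP.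
  have [ae|ne] := eqVneq a e; last first.
    by rewrite (pihomog_ne0 _ hom)// gtn_eqF// -addSn leq_add// ltn_neqAle eq_sym ne.
  subst a; have [bd|ne] := eqVneq b d; first by subst b; rewrite pihomog_dE.
  by rewrite (pihomog_ne0 _ hom)// gtn_eqF// -addnS leq_add// ltn_neqAle eq_sym ne.
rewrite (bigD1 (Ordinal ek))//= [X in _ + X]big1 ?addr0 => [|a ae].
  rewrite mulr_sumr raddf_sum (bigD1 (Ordinal dk))//= main !eqxx big1 ?addr0//.
  by move=> b bd; rewrite main eqxx (_ : (b : nat) == d = false)//; apply: negbTE.
rewrite mulr_sumr raddf_sum big1// => b _.
by rewrite /= main (_ : (a : nat) == e = false)//; apply: negbTE.
Qed.

Lemma pihomog_min p : p != 0 -> exists2 e, homc e p != 0 & forall a, (a < e)%N ->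
  homc a p = 0.
Proof.
move=> p0; have ex : exists e, homc e p != 0.
  apply: contrapT => /forallNP h; case/eqP: p0.
  by rewrite (@pihomog_partitionE _ _ mdeg _ p (leqnn _)) big1// => i _;
    apply/eqP/negPn/negP/h.
exists (ex_minn ex); case: ex_minnP => // m _ mmin a am.
by apply/eqP/negPn/negP => /mmin; rewrite leqNgt am.
Qed.

(** Let d be the least degree of a nonzero component of any w_j. As each u_i w_j is homogeneous of
    degree r, every nonzero u_i starts exactly in degree r - d. Comparing lowest parts, u_i and w_j
    may be replaced by their components of degrees r - d and d. *)
Lemma homog_rank1_factorization (I J : finType) (N : I -> J -> {mpoly R[n]}) i0 j0 u w r :
  N i0 j0 != 0 -> (forall i j, N i j \is r.-homog) ->
  (forall i j, N i j = u i * w j) ->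
  exists (d : nat) u' w', [/\ (d <= r)%N, forall j, w' j \is d.-homog,
    forall i, u' i \is (r - d).-homog & forall i j, N i j = u' i * w' j].
Proof.
move=> N0 homN Nuw.
have u0 : u i0 != 0 by apply: contraNneq N0 => u0; rewrite Nuw u0 mul0r.
have w0 : w j0 != 0 by apply: contraNneq N0 => w0; rewrite Nuw w0 mulr0.
have ex : exists d, [exists j, homc d (w j) != 0].
  by have [d wd _] := pihomog_min w0; exists d; apply/existsP; exists j0.
have [d /existsP[j1 wd] dmin] := ex_minnP ex.
have lowd j b : (b < d)%N -> homc b (w j) = 0.
  move=> bd; apply/eqP/negPn/negP => wb;
    suff /dmin : [exists j, homc b (w j) != 0] by rewrite leqNgt bd.
  by apply/existsP; exists j.
have ordu i e : homc e (u i) != 0 -> (forall a, (a < e)%N -> homc a (u i) = 0) ->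
  (e + d)%N = r.
  move=> ue ulow; apply/eqP/negPn/negP => ne.
  have := pihomog_lowM ulow (lowd j1); rewrite -Nuw (pihomog_ne0 _ (homN i j1)) 1?eq_sym//.
  by move/esym/eqP; rewrite mulf_eq0 (negbTE ue) (negbTE wd).
have dr : (d <= r)%N.
  by have [e ue ulow] := pihomog_min u0; rewrite -(ordu _ _ ue ulow) leq_addl.
exists d, (fun i => homc (r - d)%N (u i)), (fun j => homc d (w j)); split=> // [j|i|i j].
- exact: pihomogP.
- exact: pihomogP.
rewrite -pihomog_lowM ?subnK -?Nuw ?pihomog_dE//; last exact: lowd.
move=> a ad; have [->|ui0] := eqVneq (u i) 0; first by rewrite pihomog0.
have [e ue ulow] := pihomog_min ui0; apply: (ulow).
by move: ad; rewrite -(ordu _ _ ue ulow) addnK.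
Qed.

End HomogFactor.

(** * Linear independence *)

Section LinearAlgebra.
Variables (K : fieldType).

Lemma hom_exists (U W : vectType K) (f : U -> W) : linear f ->
  exists g : 'Hom(U, W), forall u, g u = f u.
Proof.
move=> lin; pose g : {linear U -> W} := HB.pack f (GRing.isLinear.Build K U W *:%R f lin).
by exists (linfun g) => u; rewrite lfunE.
Qed.

Lemma linear_lincomb (U W : vectType K) (f : 'Hom(U, W)) n (c : 'I_n -> K) (u : 'I_n -> U) :
  f (\sum_i c i *: u i) = \sum_i c i *: f (u i).
Proof. by rewrite linear_sum; apply: eq_bigr => i _; rewrite linearZ. Qed.

Definition indep (U : vectType K) n (u : 'I_n -> U) :=
  forall c : 'I_n -> K, \sum_i c i *: u i = 0 -> forall i, c i = 0.

Lemma nth_enum_map (T : Type) (x0 : T) n (u : 'I_n -> T) (i : 'I_n) :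
  nth x0 [seq u j | j <- enum 'I_n] i = u i.
Proof. by rewrite (nth_map i) ?nth_ord_enum// size_enum_ord. Qed.

Lemma freeP_indep (U : vectType K) n (u : 'I_n -> U) :
  free [seq u i | i <- enum 'I_n] <-> indep u.
Proof.
have sz : size [seq u i | i <- enum 'I_n] == n by rewrite size_map size_enum_ord.
have E c : \sum_(i < n) c i *: (Tuple sz)`_i = \sum_i c i *: u i.
  by apply: eq_bigr => i _; rewrite nth_enum_map.
split=> [/(@freeP _ _ _ (Tuple sz)) h c|h]; first by rewrite -E; apply: h.
by apply/(@freeP _ _ _ (Tuple sz)) => c; rewrite E; apply: h.
Qed.

Lemma indep_dual (U : vectType K) n (u : 'I_n -> U) : indep u ->
  exists l : 'I_n -> 'Hom(U, K^o), forall i j, l i (u j) = (i == j)%:R.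
Proof.
move=> /freeP_indep fu; have sz : size [seq u i | i <- enum 'I_n] == n
  by rewrite size_map size_enum_ord.
have /choice[l lE] : forall i : 'I_n, exists l : 'Hom(U, K^o), forall v,
  l v = coord (Tuple sz) i v.
  by move=> i; apply: hom_exists => c v w; rewrite linearP.
exists l => i j; rewrite lE -(nth_enum_map 0 u j).
by rewrite eq_sym; exact: (@coord_free _ _ _ (Tuple sz) j i fu).
Qed.

Lemma indep_det (U : vectType K) n (u : 'I_n -> U) (l : 'I_n -> 'Hom(U, K^o)) :
  \det (\matrix_(i, j) l i (u j)) != 0 -> indep u.
Proof.
set G := \matrix_(i, j) _ => G0 c cu i.
have Gu : G \in unitmx by rewrite unitmxE unitfE.
have : G *m (\col_j c j) = 0.
  apply/matrixP => a b; rewrite !mxE; have := linear_lincomb (l a) c u.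
  by rewrite cu linear0 => e; rewrite [RHS]e; apply: eq_bigr => j _; rewrite !mxE mulrC.
move/(congr1 (mulmx (invmx G))); rewrite mulKmx// mulmx0 => /matrixP/(_ i 0).
by rewrite !mxE.
Qed.

Lemma indep_dim (U : vectType K) (W : {vspace U}) n (u : 'I_n -> U) :
  indep u -> (forall i, u i \in W) -> (n <= \dim W)%N.
Proof.
move=> /freeP_indep fu uW; have : (<<[seq u i | i <- enum 'I_n]>> <= W)%VS.
  by apply/span_subvP => _ /mapP[i _ ->].
by move/dimvS; rewrite (eqP fu) size_map size_enum_ord.
Qed.

Lemma indep_span (U : vectType K) (W : {vspace U}) n (u : 'I_n -> U) :
  indep u -> (forall i, u i \in W) -> \dim W = n ->
  forall w, w \in W -> exists c, w = \sum_i c i *: u i.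
Proof.
move=> /freeP_indep fu uW dW w wW.
have bas : basis_of W [seq u i | i <- enum 'I_n].
  rewrite basisEfree fu size_map size_enum_ord dW leqnn andbT.
  by apply/span_subvP => _ /mapP[i _ ->].
have sz : size [seq u i | i <- enum 'I_n] == n by rewrite size_map size_enum_ord.
exists (fun i => coord (Tuple sz) i w); rewrite {1}(coord_basis (X := Tuple sz) bas wW).
by apply: eq_bigr => i _; rewrite nth_enum_map.
Qed.

Lemma indep_basis (U : vectType K) (W : {vspace U}) n (u : 'I_n -> U) :
  indep u -> (forall i, u i \in W) -> \dim W = n -> basis_of W [seq u i | i <- enum 'I_n].
Proof.
move=> /freeP_indep fu uW dW.
rewrite basisEfree fu size_map size_enum_ord dW leqnn andbT.
by apply/span_subvP => _ /mapP[i _ ->].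
Qed.

Lemma indep_inj (U : vectType K) n (u : 'I_n -> U) : indep u ->
  forall c d : 'I_n -> K, \sum_i c i *: u i = \sum_i d i *: u i -> c =1 d.
Proof.
move=> iu c d /eqP; rewrite -subr_eq0 -sumrB => /eqP e i.
apply/eqP; rewrite -subr_eq0; apply/eqP; apply: (iu (fun i => c i - d i)).
by rewrite -[RHS]e; apply: eq_bigr => j _; rewrite scalerBl.
Qed.

End LinearAlgebra.

(** * Regular functions on projective space *)

Section RegularFunctions.
Variables (k : closedFieldType) (V : vectType k).
Implicit Types (x y : pspace V) (P Q : {mpoly k[\dim {:V}]}) (f g : pspace V -> k).

Definition eval_form P (v : V) : k := P.@[fun i => coord (vbasis {:V}) i v].

Lemma form_atE P x : form_at P x = eval_form P (rep x). Proof. by []. Qed.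

Lemma rep_neq0 x : rep x != 0.
Proof. by rewrite /rep vpick0 -dimv_eq0 (eqP (valP x)). Qed.

Lemma rep_line x : val x = <[rep x]>%VS.
Proof.
apply/eqP; rewrite eq_sym eqEdim dim_vline rep_neq0 (eqP (valP x)) leqnn andbT.
exact: memv_pick.
Qed.

Lemma rep_eq x y : rep y \in <[rep x]>%VS -> y = x.
Proof.
move=> yx; apply: val_inj; rewrite !rep_line; apply/eqP.
by rewrite eqEdim !dim_vline !rep_neq0 leqnn andbT.
Qed.

Lemma pspace_pt (v : V) : v != 0 -> exists x, exists2 c, c != 0 & rep x = c *: v.
Proof.
move=> v0; have d1 : \dim <[v]> == 1%N by rewrite dim_vline v0.
pose x : pspace V := Sub <[v]>%VS d1; exists x.
have /vlineP[c e] : rep x \in <[v]>%VS by apply: memv_pick.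
by exists c => //; apply: contraNneq (rep_neq0 x) => c0; rewrite e c0 scale0r.
Qed.

Lemma eval_formZ p P (c : k) v : P \is p.-homog ->
  eval_form P (c *: v) = c ^+ p * eval_form P v.
Proof.
move=> /dhomogP hP; rewrite /eval_form !mevalE mulr_sumr big_seq [RHS]big_seq.
apply: eq_bigr => m /hP mp; rewrite mulrCA; congr (_ * _).
have <- : mdeg m = p := mp.
rewrite mdegE -prodrXr -big_split /=; apply: eq_bigr => i _.
by rewrite linearZ exprMn.
Qed.

Lemma eval_formM P Q v : eval_form (P * Q) v = eval_form P v * eval_form Q v.
Proof. exact: mevalM. Qed.

Definition linear_form (h : V -> k) : {mpoly k[\dim {:V}]} :=
  \sum_(i < \dim {:V}) h (vbasis {:V})`_i *: 'X_i.

Lemma linear_form_homog h : linear_form h \is 1.-homog.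
Proof. by apply: rpred_sum => i _; apply: rpredZ; rewrite dhomogX; apply/eqP;
  apply: mdeg1. Qed.

Lemma eval_linear_form h v : linear (h : V -> k^o) -> eval_form (linear_form h) v = h v.
Proof.
move=> hl; have [g gE] := hom_exists hl.
rewrite /eval_form raddf_sum /= {2}(coord_vbasis (memvf v)) -(gE (\sum_i _)) linear_lincomb.
by apply: eq_bigr => i _; rewrite mevalZ mevalXU gE mulrC.
Qed.

Lemma coord_form_neq0 x : exists i, form_at 'X_i x != 0.
Proof.
apply: contrapT => /forallNP h; have /eqP := rep_neq0 x; apply.
rewrite (coord_vbasis (memvf (rep x))) big1// => i _.
have /negP/negPn/eqP := h i; rewrite /form_at mevalXU => ->.
by rewrite scale0r.
Qed.

Lemma near_ptT x : near_pt x (fun=> True).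
Proof.
exists 0%N, 1; split=> //; first exact: dhomog1.
by rewrite /form_at meval1 oner_eq0.
Qed.

Lemma near_ptS x (A B : pspace V -> Prop) : (forall y, A y -> B y) -> near_pt x A ->
  near_pt x B.
Proof. by move=> AB [q [Q [hQ Qx QA]]]; exists q, Q; split=> // y /QA/AB. Qed.

Lemma near_ptI x (A B : pspace V -> Prop) :
  near_pt x A -> near_pt x B -> near_pt x (fun y => A y /\ B y).
Proof.
move=> [p [P [hP Px PA]]] [q [Q [hQ Qx QB]]]; exists (p + q)%N, (P * Q).
split=> [||y]; [exact: dhomogM | by rewrite /form_at mevalM mulf_neq0 |].
by rewrite /form_at mevalM mulf_eq0 negb_or => /andP[/PA ? /QB].
Qed.

Lemma near_pt_all x n (A : 'I_n -> pspace V -> Prop) :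
  (forall i, near_pt x (A i)) -> near_pt x (fun y => forall i, A i y).
Proof.
elim: n A => [|n IH] A h; first by apply: near_ptS (near_ptT x) => y _ [].
apply: near_ptS (near_ptI (h ord0) (IH (fun i => A (lift ord0 i)) (fun i => h _))).
by move=> y [A0 Al] i; case: (unliftP ord0 i) => [j ->|->].
Qed.

Lemma near_pt_self x (A : pspace V -> Prop) : near_pt x A -> A x.
Proof. by move=> [q [Q [_ Qx]]]; apply. Qed.

Lemma near_pt_near x (A : pspace V -> Prop) : near_pt x A -> near_pt x (fun y =>
  near_pt y A).
Proof. by move=> [q [Q [hQ Qx QA]]]; exists q, Q; split=> // y Qy; exists q, Q. Qed.

Lemma regular_eq j f g x : near_pt x (fun y => f y = g y) -> regular j f x -> regular j g x.
Proof.
move=> [p [P [hP Px PA]]] [a [b [N [D [hN hD e Dx De]]]]].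
(* The factor P confines the new denominator to the open set on which f = g is known. *)
exists (a + p)%N, (b + p)%N, (N * P), (D * P); split; try exact: dhomogM.
- by lia.
- by rewrite /form_at mevalM mulf_neq0.
move=> y; rewrite /form_at !mevalM mulf_eq0 negb_or => /andP[Dy Py].
by rewrite -PA// De// -mulf_div divff// mulr1.
Qed.

Lemma regular_near j f x : regular j f x -> near_pt x (regular j f).
Proof.
by move=> [a [b [N [D [hN hD e Dx De]]]]]; exists b, D; split=> // y Dy; exists a, b, N, D.
Qed.

Lemma regular_neq0 j f x : regular j f x -> f x != 0 -> near_pt x (fun y => f y != 0).
Proof.
move=> [a [b [N [D [hN hD e Dx De]]]]]; rewrite De// mulf_eq0 negb_or => /andP[Nx _].
exists (a + b)%N, (N * D); split; [exact: dhomogM | by rewrite /form_at mevalM mulf_neq0 |].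
move=> y; rewrite /form_at mevalM mulf_eq0 negb_or => /andP[Ny Dy].
by rewrite De// mulf_neq0 ?invr_eq0.
Qed.

Lemma regular_form p P x : P \is p.-homog -> regular p%:Z (form_at P) x.
Proof.
move=> hP; exists p, 0%N, P, 1; split=> //; [exact: dhomog1 | by rewrite subr0 | |].
  by rewrite /form_at meval1 oner_eq0.
by move=> y _; rewrite /form_at meval1 divr1.
Qed.

Lemma regular_lin (h : V -> k) x : linear (h : V -> k^o) -> regular 1 (fun y =>
  h (rep y)) x.
Proof.
move=> hl; apply: regular_eq (regular_form x (linear_form_homog h)).
by apply: near_ptS (near_ptT x) => y _; rewrite form_atE eval_linear_form.
Qed.

Lemma regular_cst c x : regular 0 (fun=> c) x.
Proof.
apply: regular_eq (regular_form (p := 0) (P := c%:MP) x _) => [|].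
  by apply: near_ptS (near_ptT x) => y _; rewrite /form_at mevalC.
by rewrite -[c%:MP]mulr1 mul_mpolyC; apply/rpredZ/dhomog1.
Qed.

Lemma regularM i j f g x : regular i f x -> regular j g x ->
  regular (i + j) (fun y => f y * g y) x.
Proof.
move=> [a [b [N [D [hN hD <- Dx De]]]]] [a' [b' [N' [D' [hN' hD' <- Dx' De']]]]].
exists (a + a')%N, (b + b')%N, (N * N'), (D * D'); split; try exact: dhomogM.
- by lia.
- by rewrite /form_at mevalM mulf_neq0.
move=> y; rewrite /form_at !mevalM mulf_eq0 negb_or => /andP[Dy Dy'].
by rewrite De// De'// mulf_div.
Qed.

Lemma regularV j f x : regular j f x -> f x != 0 -> regular (- j) (fun y => (f y)^-1) x.
Proof.
move=> [a [b [N [D [hN hD <- Dx De]]]]]; rewrite De// mulf_eq0 negb_or => /andP[Nx _].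
exists (b + b)%N, (a + b)%N, (D * D), (N * D); split; try exact: dhomogM.
- by lia.
- by rewrite /form_at mevalM mulf_neq0.
move=> y; rewrite /form_at !mevalM mulf_eq0 negb_or => /andP[Ny Dy].
by rewrite De// invf_div -mulf_div divff// mulr1.
Qed.

Lemma regularD j f g x : regular j f x -> regular j g x -> regular j (fun y => f y + g y) x.
Proof.
move=> [a [b [N [D [hN hD e Dx De]]]]] [a' [b' [N' [D' [hN' hD' e' Dx' De']]]]].
exists (a + b')%N, (b + b')%N, (N * D' + N' * D), (D * D'); split.
- apply: rpredD; first exact: dhomogM.
  suff -> : (a + b' = a' + b)%N by apply: dhomogM.
  by move: e e'; lia.
- exact: dhomogM.
- by lia.
- by rewrite /form_at mevalM mulf_neq0.
move=> y; rewrite /form_at mevalD !mevalM mulf_eq0 negb_or => /andP[Dy Dy'].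
by rewrite De// De'// addf_div// mulrC.
Qed.

(** A local generator of O(j): the j-th power of a coordinate that does not vanish at x. *)
Lemma unit_regular j x : exists f, regular j f x /\ f x != 0.
Proof.
have [i Xi] := coord_form_neq0 x.
have rX n : regular n%:Z (fun y => form_at 'X_i y ^+ n) x.
  elim: n => [|n IH].
    by apply: regular_eq (regular_cst 1 x); apply: near_ptS (near_ptT x).
  have -> : n.+1%:Z = 1%N%:Z + n%:Z by lia.
  have h1 : regular 1%N%:Z (form_at 'X_i) x.
    by apply: regular_form; rewrite dhomogX; apply/eqP/mdeg1.
  apply: regular_eq (regularM h1 IH).
  by apply: near_ptS (near_ptT x) => y _; rewrite exprS.
case: j => n; first by exists (fun y => form_at 'X_i y ^+ n); rewrite expf_neq0.
exists (fun y => (form_at 'X_i y ^+ n.+1)^-1); rewrite invr_eq0 expf_neq0//.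
by split=> //; rewrite NegzE; apply: regularV (rX _) _; rewrite expf_neq0.
Qed.

Lemma regular0 j x : regular j (fun=> 0 : k) x.
Proof.
have [f [rf _]] := unit_regular j x; have := regularM rf (regular_cst 0 x).
rewrite addr0; apply: regular_eq; apply: near_ptS (near_ptT x) => y _.
by rewrite mulr0.
Qed.

Lemma regular_sum j (I : finType) (f : I -> pspace V -> k) x :
  (forall i, regular j (f i) x) -> regular j (fun y => \sum_i f i y) x.
Proof.
move=> rf; elim: (index_enum I) => [|i s IH].
  by apply: regular_eq (regular0 j x); apply: near_ptS (near_ptT x) => y _; rewrite big_nil.
by apply: regular_eq (regularD (rf i) IH); apply: near_ptS (near_ptT x) => y _;
  rewrite big_cons.
Qed.

Lemma regular0M j f g x : regular 0 f x -> regular j g x -> regular j (fun y =>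
  f y * g y) x.
Proof. by move=> rf rg; rewrite -[j]add0r; apply: regularM. Qed.

Lemma regular_prod (I : finType) (d : I -> int) (f : I -> pspace V -> k) x :
  (forall i, regular (d i) (f i) x) -> regular (\sum_i d i) (fun y => \prod_i f i y) x.
Proof.
move=> rf; elim: (index_enum I) => [|i s IH].
  rewrite big_nil; apply: regular_eq (regular_cst 1 x).
  by apply: near_ptS (near_ptT x) => y _; rewrite big_nil.
rewrite big_cons; apply: regular_eq (regularM (rf i) IH).
by apply: near_ptS (near_ptT x) => y _; rewrite big_cons.
Qed.

Lemma regular0_prod (I : finType) (f : I -> pspace V -> k) x :
  (forall i, regular 0 (f i) x) -> regular 0 (fun y => \prod_i f i y) x.
Proof. by move=> /regular_prod; rewrite big1. Qed.

Lemma regular_ext j f g x : (forall y, f y = g y) -> regular j f x -> regular j g x.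
Proof. by move=> fg; apply: regular_eq; apply: near_ptS (near_ptT x). Qed.

Lemma regular_det_rows n (d : 'I_n -> int) (A : pspace V -> 'M[k]_n) x :
  (forall i j, regular (d i) (fun y => A y i j) x) ->
  regular (\sum_i d i) (fun y => \det (A y)) x.
Proof.
move=> rA; apply: regular_sum => s; apply: regular0M; first exact: regular_cst.
by apply: regular_prod => i; apply: rA.
Qed.

Lemma regular_det n (A : pspace V -> 'M[k]_n) x :
  (forall i j, regular 0 (fun y => A y i j) x) -> regular 0 (fun y => \det (A y)) x.
Proof. by move=> /(@regular_det_rows _ (fun=> 0)); rewrite big1. Qed.

Lemma regular_cofactor n (A : pspace V -> 'M[k]_n) x a b :
  (forall i j, regular 0 (fun y => A y i j) x) -> regular 0 (fun y => cofactor (A y) a b) x.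
Proof.
move=> rA; apply: regular0M; first exact: regular_cst.
by apply: regular_det => i j; apply: regular_ext (rA _ _) => y; rewrite !mxE.
Qed.

Section Vectors.
Variable B : vectType k.
Implicit Types s : pspace V -> B.

(** Unfolds to the regular sections of [tensO V B j], so that what follows applies by conversion to
    the source and target of [psi]. *)
Definition regvec j s x := forall l : 'Hom(B, k^o), regular j (fun y => l (s y)) x.

Lemma regvec_scale i j f s x : regular i f x -> regvec j s x -> regvec (i + j) (fun y =>
  f y *: s y) x.
Proof.
by move=> rf rs l; apply: regular_ext (regularM rf (rs l)) => y; rewrite linearZ.
Qed.

Lemma regvec_sum j n (s : 'I_n -> pspace V -> B) x :
  (forall i, regvec j (s i) x) -> regvec j (fun y => \sum_i s i y) x.
Proof.
by move=> rs l; apply: regular_ext (regular_sum (fun i => rs i l)) => y; rewrite linear_sum.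
Qed.

Lemma regvec_cst b x : regvec 0 (fun=> b) x.
Proof. by move=> l; apply: regular_cst. Qed.

(** Independence is open: paired with functionals dual to the e i at x, the vectors give a regular
    determinant equal to 1 at x. *)
Lemma regvec_near_indep r (e : 'I_r -> pspace V -> B) x : (forall i, regvec 0 (e i) x) ->
  indep (fun i => e i x) -> near_pt x (fun y => indep (fun i => e i y)).
Proof.
move=> re ind; have [l lE] := indep_dual ind.
have := regular_det (A := fun y => \matrix_(i, j) l i (e j y)) (x := x).
move=> /(_ _)/regular_neq0 => h; apply: near_ptS (h _ _).
- by move=> y; apply: indep_det.
- by move=> i j; apply: regular_ext (re j (l i)) => y; rewrite mxE.
rewrite (_ : \matrix_(i, j) _ = 1%:M) ?det1 ?oner_eq0//.
by apply/matrixP => i j; rewrite !mxE lE.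
Qed.

(* Cramer's rule. *)
Lemma regular_coords r (e : 'I_r -> pspace V -> B) (v : pspace V -> B) (c : 'I_r ->
  pspace V -> k) x :
  (forall i, regvec 0 (e i) x) -> regvec 0 v x -> indep (fun i => e i x) ->
  near_pt x (fun y => v y = \sum_i c i y *: e i y) -> forall i, regular 0 (c i) x.
Proof.
move=> re rv ind vE i; have [l lE] := indep_dual ind.
pose G y : 'M[k]_r := \matrix_(i, j) l i (e j y).
have rG a b : regular 0 (fun y => G y a b) x.
  by apply: regular_ext (re b (l a)) => y; rewrite mxE.
have Gx : \det (G x) != 0.
  rewrite (_ : G x = 1%:M) ?det1 ?oner_eq0//.
  by apply/matrixP => a b; rewrite !mxE lE.
have rd := regular_det rG; have := regularV rd Gx; rewrite oppr0 => rdV.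
have rs : regular 0 (fun y => \sum_j cofactor (G y) j i * l j (v y)) x.
  by apply: regular_sum => j; apply: regular0M (rv (l j)); apply: regular_cofactor.
apply: regular_eq (regular0M rdV rs).
apply: near_ptS (near_ptI (regular_neq0 rd Gx) vE) => y [Gy ->].
have e1 : \sum_j cofactor (G y) j i * l j (\sum_i0 c i0 y *: e i0 y) =
    (\adj (G y) *m (G y *m \col_j c j y)) i 0.
  rewrite mxE; apply: eq_bigr => j _; rewrite !mxE linear_lincomb; congr (_ * _).
  by apply: eq_bigr => a _; rewrite !mxE mulrC.
by rewrite e1 mulmxA mul_adj_mx mul_scalar_mx !mxE mulrA mulVf// mul1r.
Qed.

End Vectors.

End RegularFunctions.

(** * Lines in projective space and functions without zeros *)

Section Lines.
Variables (k : closedFieldType) (V : vectType k).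
Implicit Types (x y : pspace V) (P Q : {mpoly k[\dim {:V}]}).

Definition line_poly (v0 v1 : V) P : {poly k} :=
  mmap polyC (fun i => (coord (vbasis {:V}) i v0)%:P + (coord (vbasis {:V}) i v1)%:P *
    'X) P.

Lemma horner_line_poly v0 v1 P t : (line_poly v0 v1 P).[t] = eval_form P (v0 + t *: v1).
Proof.
rewrite /line_poly /mmap horner_sum /eval_form mevalE; apply: eq_bigr => m _.
rewrite hornerM hornerC /mmap1 horner_prod; congr (_ * _); apply: eq_bigr => i _.
by rewrite horner_exp !hornerE linearD linearZ /= mulrC.
Qed.

Lemma two_vectors : (1 < \dim {:V})%N -> forall v : V, exists w, w \notin <[v]>%VS.
Proof.
move=> d2 v; have : ~~ ({:V} <= <[v]>)%VS.
  apply: contraL d2 => /dimvS; rewrite -leqNgt => /leq_trans; apply.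
  by rewrite dim_vline; case: (_ != _).
by case/subvPn => w _ wv; exists w.
Qed.

(** On a line through x only finitely many points rep x + t w lie outside the given neighbourhood,
    so some t != 0 is left. *)
Lemma near_pt_other x (A : pspace V -> Prop) : (1 < \dim {:V})%N -> near_pt x A ->
  exists2 y, y <> x & A y.
Proof.
move=> d2 [q [Q [hQ Qx QA]]]; have [w wx] := two_vectors d2 (rep x).
have : line_poly (rep x) w Q != 0.
  apply: contraNneq Qx => Q0; have := horner_line_poly (rep x) w Q 0.
  by rewrite Q0 horner0 scale0r addr0 form_atE => <-.
case/(horner_avoid [:: 0]) => t; rewrite inE horner_line_poly => t0 Qt.
have tw : t *: w \notin <[rep x]>%VS by rewrite rpredZeq negb_or t0.
have v0 : rep x + t *: w != 0.
  by apply: contraNneq tw => /eqP; rewrite addrC addr_eq0 => /eqP->;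
    rewrite rpredN memv_line.
have [y [c c0 yE]] := pspace_pt v0; exists y.
  move=> yx; case/negP: tw; rewrite -(rpredDl _ (memv_line (rep x))).
  by rewrite -[_ + _](scalerK c0) -yE yx rpredZ// memv_line.
by apply: QA; rewrite form_atE yE (eval_formZ _ _ hQ) mulf_neq0// expf_neq0.
Qed.

(* A and B are the restrictions of two forms of degrees p and q to the chart of
   a line around its point at infinity. *)
Lemma monomial_balance (A B : {poly k}) p q (c : k) : A.[0] != 0 -> B.[0] != 0 -> c != 0 ->
  (forall s, s != 0 -> s ^+ q * A.[s] = c * (s ^+ p * B.[s])) -> p = q.
Proof.
move=> A0 B0 c0 h.
have key (C D : {poly k}) a b d : C.[0] != 0 ->
    (forall s, s != 0 -> s ^+ a * C.[s] = d * (s ^+ b * D.[s])) -> (a < b)%N -> False.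
  move=> C0 e ab; suff CD : C = d *: ('X^(b - a) * D).
    by case/eqP: C0; rewrite CD hornerZ hornerM hornerXn expr0n subn_eq0 leqNgt ab mul0r
      mulr0.
  apply/eqP; rewrite -subr_eq0; apply/negPn/negP => /(horner_avoid [:: 0])[s].
  rewrite inE => s0; rewrite hornerD hornerN hornerZ hornerM hornerXn subr_eq0 => /eqP;
    apply.
  apply: (mulfI (expf_neq0 a s0)); rewrite e// -{1}(subnK (ltnW ab)) exprD.
  by move: (s ^+ a) (s ^+ (b - a)) => u w; ring.
have [lt|gt|//] := ltngtP p q; exfalso.
  apply: (key B A p q c^-1 B0 _ lt) => s s0; rewrite h// mulKf//.
exact: (key A B q p c A0 h gt).
Qed.

(* On a line phi is the quotient of two coprime polynomials without zeros, hence
   constant away from infinity. *)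
Lemma nonvanishing_regular_degree (e : int) (phi : pspace V -> k) : (1 < \dim {:V})%N ->
  (forall x, regular e phi x) -> (forall x, phi x != 0) -> e = 0.
Proof.
move=> d2 reg_phi phi0; have v0n : exists v0 : V, v0 != 0.
  exists (vpick fullv); rewrite vpick0 -dimv_eq0; by case: (\dim _) d2.
have [v0 v00] := v0n; have [v1 v1v0] := two_vectors d2 v0.
have pt0 t : v1 + t *: v0 != 0.
  apply: contraNneq v1v0 => /eqP; rewrite addr_eq0 => /eqP->.
  by rewrite rpredN rpredZ// memv_line.
have flip s : s != 0 -> v1 + s *: v0 = s *: (v0 + s^-1 *: v1).
  by move=> s0; rewrite scalerDr scalerA divff// scale1r addrC.
have pt1 t : v0 + t *: v1 != 0.
  have [->|t0] := eqVneq t 0; first by rewrite scale0r addr0.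
  have := pt0 t^-1; rewrite flip ?invr_eq0// invrK scaler_eq0 negb_or => /andP[].
  by [].
have chart v : v != 0 -> exists p q P Q, [/\ P \is p.-homog, Q \is q.-homog,
    p%:Z - q%:Z = e, eval_form Q v != 0 & eval_form P v != 0 /\
    forall y, form_at Q y != 0 -> phi y = form_at P y / form_at Q y].
  move=> vn; have [x [c c0 xE]] := pspace_pt vn.
  have [p [q [P [Q [hP hQ pq Qx QE]]]]] := reg_phi x; exists p, q, P, Q.
  have := phi0 x; rewrite QE// mulf_eq0 negb_or !form_atE xE (eval_formZ _ _ hP) mulf_eq0
    negb_or.
  move: Qx; rewrite form_atE xE (eval_formZ _ _ hQ) mulf_eq0 negb_or.
  by move=> /andP[_ Qv] /andP[/andP[_ Pv] _].
have v1n : v1 != 0 by have := pt0 0; rewrite scale0r addr0.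
(* The reference quotient P0 / Q0 is taken at v1, the point at infinity of the line v0 + t v1, so
   that neither form vanishes there. *)
have [p0 [q0 [P0 [Q0 [hP0 hQ0 pq0 Q0v [P0v phi0E]]]]]] := chart v1 v1n.
have line0 R : eval_form R v1 != 0 -> line_poly v1 v0 R != 0.
  move=> Rv; apply: contraNneq Rv => R0; have := horner_line_poly v1 v0 R 0.
  by rewrite R0 horner0 scale0r addr0 => <-.
have line1 d R : R \is d.-homog -> eval_form R v1 != 0 -> line_poly v0 v1 R != 0.
  move=> hR /line0/(horner_avoid [:: 0])[s]; rewrite inE => s0.
  rewrite horner_line_poly flip// (eval_formZ _ _ hR) mulf_eq0 negb_or => /andP[_].
  by rewrite -horner_line_poly; apply: contraNneq => ->; rewrite horner0.
set A0 := line_poly v0 v1 P0; set B0 := line_poly v0 v1 Q0.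
have A0n : A0 != 0 by apply: line1 hP0 P0v.
have B0n : B0 != 0 by apply: line1 hQ0 Q0v.
(* Near v0 + t v1, phi is another quotient of forms, neither of which vanishes at that point because
   phi has no zero. It agrees with P0 / Q0 wherever both are defined. *)
have cross t : exists A1 B1 : {poly k}, [/\ A1.[t] != 0, B1.[t] != 0 & A0 * B1 = A1 * B0].
  have [p1 [q1 [P1 [Q1 [hP1 hQ1 pq1 Q1v [P1v phi1E]]]]]] := chart _ (pt1 t).
  exists (line_poly v0 v1 P1), (line_poly v0 v1 Q1); rewrite !horner_line_poly; split=> //.
  set A1 := line_poly _ _ P1; set B1 := line_poly _ _ Q1.
  have B1n : B1 != 0 by apply: contraNneq Q1v => B10;
    rewrite -horner_line_poly -/B1 B10 horner0.
  (* The factor B0 B1 disposes of the parameters at which one of the two quotients is undefined. *)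
  suff : (A0 * B1 - A1 * B0) * (B0 * B1) = 0.
    by move/eqP; rewrite !mulf_eq0 (negbTE B0n) (negbTE B1n) !orbF subr_eq0 => /eqP.
  apply: horner_eq0 => s; rewrite hornerM [(B0 * B1).[s]]hornerM.
  have [->|B0s] := eqVneq B0.[s] 0; first by rewrite mul0r mulr0.
  have [->|B1s] := eqVneq B1.[s] 0; first by rewrite !mulr0.
  rewrite (_ : (A0 * B1 - A1 * B0).[s] = 0) ?mul0r//; apply/eqP.
  rewrite hornerD hornerN !hornerM subr_eq0 /A0 /B0 /A1 /B1 !horner_line_poly.
  have [y [c c0 yE]] := pspace_pt (pt1 s).
  have Q0y : form_at Q0 y != 0.
    by rewrite form_atE yE (eval_formZ _ _ hQ0) mulf_neq0 ?expf_neq0// -horner_line_poly.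
  have Q1y : form_at Q1 y != 0.
    by rewrite form_atE yE (eval_formZ _ _ hQ1) mulf_neq0 ?expf_neq0// -horner_line_poly.
  have := phi0E y Q0y; rewrite phi1E// => /eqP; rewrite eqr_div// eq_sym !form_atE yE.
  rewrite (eval_formZ _ _ hP0) (eval_formZ _ _ hQ0) (eval_formZ _ _ hP1) (eval_formZ _ _
    hQ1).
  rewrite mulrACA [X in _ == X]mulrACA -!exprD.
  have -> : (p1 + q0 = p0 + q1)%N by clear -pq0 pq1; lia.
  by move=> /eqP h; apply/eqP; apply: (mulfI (expf_neq0 (p0 + q1)%N c0)).
have co : coprimep (A0 %/ gcdp A0 B0) (B0 %/ gcdp A0 B0).
  by apply: coprimep_div_gcd; rewrite A0n.
have gn : gcdp A0 B0 != 0 by rewrite gcdp_eq0 negb_and A0n.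
set A' := _ %/ _ in co; set B' := B0 %/ _ in co.
have AE : A0 = A' * gcdp A0 B0 by rewrite divpK ?dvdp_gcdl.
have BE : B0 = B' * gcdp A0 B0 by rewrite divpK ?dvdp_gcdr.
have cross' t : exists A1 B1 : {poly k}, [/\ A1.[t] != 0, B1.[t] != 0 & A' * B1 = A1 * B'].
  have [A1 [B1 [A1t B1t e1]]] := cross t; exists A1, B1; split=> //.
  by apply: (mulIf gn); rewrite mulrAC -AE e1 {1}BE mulrA.
have root_false t : (A'.[t] == 0) && (B'.[t] == 0) = false.
  apply/negP => /andP[At /eqP Bt].
  by have := coprimep_root co At; rewrite Bt eqxx.
(* A root of A' at t would be a root of B' too, as A1 does not vanish at t, against coprimality. The
   same holds with the roles exchanged, so A' and B' are nonzero constants. *)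
have sA : size A' = 1%N.
  apply/eqP/negPn/negP => /closed_rootP[t At]; have [A1 [B1 [A1t B1t e1]]] := cross' t.
  have := congr1 (horner^~ t) e1; rewrite !hornerM (eqP At) mul0r => /esym/eqP.
  by rewrite mulf_eq0 (negbTE A1t) /= => Bt; have := root_false t; rewrite Bt [_ == 0]At.
have sB : size B' = 1%N.
  apply/eqP/negPn/negP => /closed_rootP[t Bt]; have [A1 [B1 [A1t B1t e1]]] := cross' t.
  have := congr1 (horner^~ t) e1; rewrite !hornerM (eqP Bt) mulr0 => /eqP.
  by rewrite mulf_eq0 (negbTE B1t) orbF => At; have := root_false t; rewrite At [_ == 0]Bt.
have /size_poly1P[a a0 Aa] : size A' == 1%N by rewrite sA.
have /size_poly1P[b b0 Bb] : size B' == 1%N by rewrite sB.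
have prop t : b * eval_form P0 (v0 + t *: v1) = a * eval_form Q0 (v0 + t *: v1).
  have At : A0.[t] = a * (gcdp A0 B0).[t] by rewrite {1}AE Aa hornerM hornerC.
  have Bt : B0.[t] = b * (gcdp A0 B0).[t] by rewrite {1}BE Bb hornerM hornerC.
  by rewrite -!horner_line_poly -/A0 -/B0 At Bt mulrCA.
(* In the coordinate s = 1/t around v1, the proportionality of P0 and Q0 acquires the factors s^p0
   and s^q0. *)
have := @monomial_balance (line_poly v1 v0 P0) (line_poly v1 v0 Q0) p0 q0 (a / b).
rewrite !horner_line_poly scale0r addr0 P0v Q0v mulf_neq0 ?invr_eq0// => bal.
suff pq : p0 = q0 by rewrite -pq0 pq subrr.
apply: bal => // s s0; rewrite !horner_line_poly flip// (eval_formZ _ _ hP0) (eval_formZ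
  _ _ hQ0).
move: (s ^+ p0) (s ^+ q0) (prop s^-1) => u w e1; apply: (mulfI b0).
rewrite (_ : b * _ = w * u * (b * eval_form P0 (v0 + s^-1 *: v1))); last by ring.
by rewrite e1; field.
Qed.

End Lines.

Lemma dhomog_bigprod (R : idomainType) n (I : finType) (F : I -> {mpoly R[n]}) (d : I ->
  nat) :
  (forall i, F i \is (d i).-homog) -> \prod_i F i \is (\sum_i d i)%N.-homog.
Proof.
move=> hF; apply: (big_ind2 (fun p e => p \is e.-homog)) => //; first exact: dhomog1.
by move=> p e q e'; apply: dhomogM.
Qed.

Lemma dhomog_det (R : idomainType) n m (A : 'M[{mpoly R[n]}]_m) (d : 'I_m -> nat) :
  (forall i j, A i j \is (d i).-homog) -> \det A \is (\sum_i d i)%N.-homog.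
Proof.
move=> hA; apply: rpred_sum => s _; rewrite rpredMsign.
by apply: dhomog_bigprod.
Qed.

(** Homogeneity spreads the vanishing from [rep x] over the line x; positive degree covers the
    origin, which is not a point of P(V). *)
Lemma form_eq0 (k : closedFieldType) (V : vectType k) p (P : {mpoly k[\dim {:V}]}) :
  P \is p.-homog -> (0 < p)%N -> (forall x : pspace V, form_at P x = 0) -> P = 0.
Proof.
move=> hP p0 hx; apply: meval_eq0 => v.
pose w := \sum_i v i *: (vbasis {:V})`_i.
have -> : P.@[v] = eval_form P w.
  by apply: meval_eq => i; rewrite /w coord_sum_free// (basis_free (vbasisP _)).
have [->|w0] := eqVneq w 0.
  by rewrite -(scale0r 0) (eval_formZ _ _ hP) expr0n gtn_eqF// mul0r.
have [x [c c0 xE]] := pspace_pt w0; have := hx x; rewrite form_atE xE (eval_formZ _ _ hP).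
by move/eqP; rewrite mulf_eq0 (negbTE (expf_neq0 _ c0)) => /eqP.
Qed.

(** * Restriction to a linear subspace *)

Section Pullback.
Variables (k : closedFieldType) (V : vectType k) (L : {vspace V}).
Local Notation incl := (@pspace_incl k V L).

Lemma rep_incl x : exists2 c, c != 0 & rep (incl x) = c *: vsval (rep x).
Proof.
have : val (incl x) = <[vsval (rep x)]>%VS.
  by rewrite /pspace_incl SubK (rep_line x) limg_line lfunE.
move=> vE; have : rep (incl x) \in val (incl x) by apply: memv_pick.
rewrite vE => /vlineP[c e]; exists c => //.
by apply: contraNneq (rep_neq0 (incl x)) => c0; rewrite e c0 scale0r.
Qed.

Lemma pullback_form p (P : {mpoly k[\dim {:V}]}) : P \is p.-homog ->
  exists2 P' : {mpoly k[\dim {:subvs_of L}]}, P' \is p.-homog &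
    forall w, eval_form P' w = eval_form P (vsval w).
Proof.
move=> /dhomogP hP; pose lin i := linear_form (fun w : subvs_of L =>
  coord (vbasis {:V}) i (vsval w)).
exists (P \mPo [tuple lin i | i < \dim {:V}]).
  rewrite comp_mpolyEX big_seq; apply: rpred_sum => m /hP mp; apply: rpredZ.
  rewrite comp_mpolyX; have <- : mdeg m = p := mp.
  rewrite mdegE; apply: dhomog_bigprod => i;
    rewrite tnth_mktuple -[m i in X in X.-homog]mul1n.
  exact/dhomogMn/linear_form_homog.
move=> w; rewrite /eval_form comp_mpoly_meval; apply: meval_eq => i.
rewrite tnth_mktuple; apply: eval_linear_form => c u v.
by rewrite !linearP.
Qed.

Lemma pullback_form_neq0 q (Q : {mpoly k[\dim {:V}]}) Q' y : Q \is q.-homog ->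
  (forall w : subvs_of L, eval_form Q' w = eval_form Q (vsval w)) ->
  (form_at Q' y != 0) = (form_at Q (incl y) != 0).
Proof.
move=> hQ QE; have [c c0 yE] := rep_incl y.
by rewrite !form_atE yE (eval_formZ _ _ hQ) QE mulf_eq0 (negbTE (expf_neq0 _ c0)).
Qed.

Lemma near_pt_incl x (A : pspace V -> Prop) : near_pt (incl x) A -> near_pt x (fun y =>
  A (incl y)).
Proof.
move=> [q [Q [hQ Qx QA]]]; have [Q' hQ' QE] := pullback_form hQ.
exists q, Q'; split=> //; first by rewrite (pullback_form_neq0 _ hQ QE).
by move=> y; rewrite (pullback_form_neq0 _ hQ QE) => /QA.
Qed.

(** The vectors [rep (incl x)] and [rep x] differ by an arbitrary scalar; it cancels because in
    degree 0 numerator and denominator have the same degree. *)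
Lemma regular_incl x f : regular 0 f (incl x) -> regular 0 (fun y => f (incl y)) x.
Proof.
move=> [p [q [P [Q [hP hQ pq Qx fE]]]]].
have [P' hP' PE] := pullback_form hP; have [Q' hQ' QE] := pullback_form hQ.
exists p, q, P', Q'; split=> //; first by rewrite (pullback_form_neq0 _ hQ QE).
move=> y; rewrite (pullback_form_neq0 _ hQ QE) => Qy; rewrite fE//.
have [c c0 yE] := rep_incl y.
rewrite !form_atE yE (eval_formZ _ _ hP) PE QE.
have -> : eval_form Q (c *: vsval (rep y)) = c ^+ p * eval_form Q (vsval (rep y)).
  by rewrite (eval_formZ _ _ hQ); congr (_ ^+ _ * _); clear -pq; lia.
by rewrite -mulf_div divff ?mul1r// expf_neq0.
Qed.

End Pullback.

(** * Maximal minors and the determinant of the cokernel *)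

Section Minors.
Variables (K : fieldType).

(* Multiply by the invertible matrix (V | Q), where V is a right inverse of
   F i0; the product is block triangular. *)
Lemma minor_kernel r m (I : Type) (F : I -> 'M[K]_(r, r + m)) (Q : 'M_(r + m, m)) i0 S0 :
  (forall i, F i *m Q = 0) -> row_free (F i0) -> S0 *m Q = 1%:M ->
  exists mu, exists2 kappa : I -> K, mu != 0 /\ kappa i0 = 1 &
    forall i S, mu * \det (col_mx (F i) S) = kappa i * \det (S *m Q).
Proof.
move=> FQ /row_freeP[V VE] SQ.
have main i S : \det (row_mx V Q) * \det (col_mx (F i) S) = \det (F i *m V) * \det (S *m Q).
  by rewrite mulrC -det_mulmx mul_col_row FQ det_lblock.
exists (\det (row_mx V Q)), (fun i => \det (F i *m V)) => //.
split; last by rewrite VE det1.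
apply/eqP => d0; have := main i0 S0; rewrite d0 mul0r VE SQ !det1 mulr1 => /esym/eqP.
by rewrite oner_eq0.
Qed.

(** Multilinearity in the rows of S Q, each a combination of rows of Q. This is the Cauchy-Binet
    formula before the maps J are grouped by their images. *)
Lemma det_mulmx_expand m n (S : 'M[K]_(m, n)) (Q : 'M_(n, m)) :
  \det (S *m Q) = \sum_(J : {ffun 'I_m ->
    'I_n}) (\prod_i S i (J i)) * \det (\matrix_(i, j) Q (J i) j).
Proof.
rewrite /determinant; under [RHS]eq_bigr => J _ do rewrite mulr_sumr.
rewrite exchange_big; apply: eq_bigr => s _ /=.
rewrite (eq_bigr (fun i => \sum_j S i j * Q j (s i))); last by move=> i _; rewrite mxE.
rewrite bigA_distr_bigA mulr_sumr; apply: eq_bigr => J _ /=.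
rewrite big_split /= mulrCA; congr (_ * (_ * _)).
by apply: eq_bigr => i _; rewrite mxE.
Qed.

(** Greedy choice: the span of fewer than \dim W vectors cannot contain W, so some u i lies outside
    it. *)
Lemma indep_selection (U : vectType K) n (u : 'I_n -> U) (W : {vspace U}) :
  (W <= <<[seq u i | i <- enum 'I_n]>>)%VS -> exists I : 'I_(\dim W) ->
    'I_n, indep (u \o I).
Proof.
move=> Wu; suff [t st ft] : exists2 t : seq 'I_n, size t = \dim W & free [seq u i | i <- t].
  have sz : size t == \dim W by rewrite st.
  exists (tnth (Tuple sz)); apply/freeP_indep.
  suff -> : [seq (u \o tnth (Tuple sz)) i | i <- enum 'I_(\dim W)] = [seq u i | i <- t]
    by [].
  exact: etrans (map_comp u (tnth (Tuple sz)) _) (congr1 (map u) (map_tnth_enum (Tuple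
    sz))).
have : forall s, (s <= \dim W)%N ->
  exists2 t : seq 'I_n, size t = s & free [seq u i | i <- t].
  elim=> [_|s IH lt]; first by exists [::]; rewrite // nil_free.
  have [t st ft] := IH (ltnW lt).
  have [i ui] : exists i, u i \notin <<[seq u i | i <- t]>>%VS.
    apply: contrapT => /forallNP h; have : (W <= <<[seq u i | i <- t]>>)%VS.
      apply: subv_trans Wu _; apply/span_subvP => _ /mapP[i _ ->].
      exact/negPn/negP/h.
    by move/dimvS; rewrite (eqP ft) size_map st leqNgt lt.
  by exists (i :: t); rewrite /= ?st// free_cons ui.
exact.
Qed.

Lemma dual_basis (U : vectType K) n : \dim {:U} = n ->
  exists (e : 'I_n -> U) (l : 'I_n -> 'Hom(U, K^o)),
    (forall i j, l i (e j) = (i == j)%:R) /\ forall u, u = \sum_i l i u *: e i.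
Proof.
move=> dU; subst n; pose e i := (vbasis {:U})`_i.
have /choice[l lE] : forall i : 'I_(\dim {:U}), exists l : 'Hom(U, K^o), forall u,
  l u = coord (vbasis {:U}) i u.
  by move=> i; apply: hom_exists => c v w; rewrite linearP.
exists (fun i => e i), l; split=> [i j|u].
  rewrite lE eq_sym.
  exact: (@coord_free _ _ _ (vbasis {:U}) j i (basis_free (vbasisP _))).
by rewrite {1}(coord_vbasis (memvf u)); apply: eq_bigr => i _; rewrite lE.
Qed.

End Minors.

Section Quotient.
Variables (K : fieldType) (B : vectType K) (I : {vspace B}).

Definition quot_proj (b : B) : subvs_of I^C := vsproj I^C (daddv_pi I^C I b).

Lemma quot_proj_is_linear : linear quot_proj.
Proof. by move=> c u v; rewrite /quot_proj !linearP. Qed.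

HB.instance Definition _ := GRing.isLinear.Build K B (subvs_of I^C) *:%R quot_proj
  quot_proj_is_linear.

Lemma quot_projK u : quot_proj (vsval u) = u.
Proof.
by rewrite /quot_proj daddv_pi_id ?vsvalK ?subvsP// capvC capv_compl.
Qed.

Lemma quot_proj0 b : b \in I -> quot_proj b = 0.
Proof.
move=> bI; suff e : daddv_pi I^C I b = 0 by rewrite /quot_proj e linear0.
have cap : (I^C :&: I = 0)%VS by rewrite capvC capv_compl.
have full : b \in (I^C + I)%VS by rewrite addvC addv_complf memvf.
have := daddv_pi_add cap full; have -> : daddv_pi I I^C b = b by apply: daddv_pi_id;
  rewrite // capv_compl.
by move=> e; apply: (addIr b); rewrite add0r.
Qed.

End Quotient.

Section ConstantRank.
Variables (k : closedFieldType) (A B : vectType k) (M : {vspace 'Hom(A, B)}) (r m : nat).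
Hypothesis rankM : constant_rank M r.
Hypothesis dimB : \dim {:B} = (r + m)%N.
Local Notation V := (subvs_of M).
Implicit Types (x y : pspace V).

Definition point_map y : 'Hom(A, B) := vsval (rep y).

Lemma rank_point_map y : \dim (limg (point_map y)) = r.
Proof.
apply: rankM; first exact: subvsP.
by apply: contraNneq (rep_neq0 y) => e; apply/eqP/val_inj.
Qed.

Local Notation quot y := (quot_proj (limg (point_map y))).

Lemma dim_quot y : m = \dim {:subvs_of (limg (point_map y))^C}.
Proof.
by rewrite dimvf /dim /= dimv_compl rank_point_map dimB addnC addnK.
Qed.

Variables (e : 'I_(r + m) -> B) (l : 'I_(r + m) -> 'Hom(B, k^o)).
Hypothesis eE : forall u, u = \sum_i l i u *: e i.

(** The matrix of B -> coker. Its entries are not regular in y, since the basis of the complement is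
    an arbitrary choice. The cast is there because the dimension of the fibre equals m only through
    [dim_quot]. *)
Definition quot_mx y : 'M[k]_(r + m, m) := \matrix_(i, j)
  coord (vbasis {:subvs_of (limg (point_map y))^C}) (cast_ord (dim_quot y) j) (quot y (e
    i)).

Definition coord_mx n (u : 'I_n -> B) : 'M[k]_(n, r + m) := \matrix_(i, j) l j (u i).

(** Coordinates of the vectors b_j, j in J, of the overview; left multiplication by it selects the
    rows J. The ring is a parameter because both scalars and polynomials occur. *)
Definition select_mx (R : nzRingType) (J : {ffun 'I_m -> 'I_(r + m)}) : 'M[R]_(m, r + m) :=
  \matrix_(i, j) (J i == j)%:R.

Lemma coord_quot_mx n (u : 'I_n -> B) y : coord_mx u *m quot_mx y = \matrix_(i, j)
  coord (vbasis {:subvs_of (limg (point_map y))^C}) (cast_ord (dim_quot y) j) (quot y (u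
    i)).
Proof.
apply/matrixP => i j; rewrite !mxE {1}(eE (u i)) linear_sum linear_sum.
by apply: eq_bigr => t _; rewrite !mxE !linearZ.
Qed.

Lemma select_quot_mx y J : select_mx k J *m quot_mx y = \matrix_(i, j) quot_mx y (J i) j.
Proof.
apply/matrixP => i j; rewrite !mxE (bigD1 (J i))//= !mxE eqxx mul1r big1 ?addr0// => t tJ.
by rewrite !mxE eq_sym (negbTE tJ) mul0r.
Qed.

Lemma quot_mx_linv y : exists S, S *m quot_mx y = 1%:M.
Proof.
pose u j := vsval (vbasis {:subvs_of (limg (point_map y))^C})`_(cast_ord (dim_quot y) j).
exists (coord_mx u); rewrite coord_quot_mx; apply/matrixP => i j; rewrite !mxE quot_projK.
rewrite coord_free ?(basis_free (vbasisP _))//.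
Qed.

(** The quotient matrix Q has a left inverse S, and 1 = \det (S Q) is a combination of its maximal
    minors. *)
Lemma quot_mx_minor_neq0 y : exists J, \det (select_mx k J *m quot_mx y) != 0.
Proof.
have [S SQ] := quot_mx_linv y; apply: contrapT => /forallNP h.
have := det1 k m; rewrite -SQ det_mulmx_expand big1 => [/esym/eqP|J _];
  first by rewrite oner_eq0.
by have /negP/negPn/eqP := h J; rewrite select_quot_mx => ->; rewrite mulr0.
Qed.

Lemma row_free_coord_mx n (u : 'I_n -> B) : indep u -> row_free (coord_mx u).
Proof.
move=> iu; apply: inj_row_free => v v0.
apply/rowP => i; rewrite mxE; apply: iu i; rewrite (eE (\sum_i _)) big1// => j _.
suff -> : l j (\sum_i v 0 i *: u i) = 0 by rewrite scale0r.
rewrite linear_lincomb; have /rowP/(_ j) := v0; rewrite !mxE => v0j.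
by rewrite -[RHS]v0j; apply: eq_bigr => i _; rewrite mxE.
Qed.

(** The case of [minor_kernel] with a single matrix: vectors of the image are killed by the quotient
    map. It compares any basis of the image with the cokernel, and is applied to the frame along a
    line. *)
Lemma minor_quot_mx y (u : 'I_r -> B) : indep u -> (forall i, u i \in limg (point_map y)) ->
  exists2 mu, mu != 0 & forall S, mu * \det (col_mx (coord_mx u) S) = \det (S *m quot_mx y).
Proof.
move=> iu uI; have [S0 S0Q] := quot_mx_linv y.
have uQ : coord_mx u *m quot_mx y = 0.
  by rewrite coord_quot_mx; apply/matrixP => i j; rewrite !mxE quot_proj0// linear0.
have [mu [kap [mu0 kap1] E]] := @minor_kernel _ _ _ unit (fun=> coord_mx u) _ tt S0
  (fun=> uQ) (row_free_coord_mx iu) S0Q.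
by exists mu => // S; rewrite (E tt) kap1 mul1r.
Qed.

Section PlueckerForms.
Hypothesis r_gt0 : (0 < r)%N.
Variable y0 : pspace V.

Definition minor_form (I : {ffun 'I_r -> 'I_(\dim {:A})}) (J : {ffun 'I_m -> 'I_(r + m)}) :
    {mpoly k[\dim {:V}]} :=
  \det (col_mx (\matrix_(i, j) linear_form (fun w : V =>
    l j (vsval w (vbasis {:A})`_(I i))))
              (select_mx _ J)).

Lemma minor_form_homog I J : minor_form I J \is r.-homog.
Proof.
(* The first r rows consist of linear forms, the last m of constants. *)
have sum_deg : (\sum_(i < r + m) (i < r))%N = r.
  rewrite big_split_ord /= (eq_bigr (fun=> 1%N)) => [|i _]; last by rewrite ltn_ord.
  by rewrite sum1_card card_ord big1 ?addn0// => i _; rewrite ltnNge leq_addr.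
rewrite -sum_deg; apply: (dhomog_det (d := fun i : 'I_(r + m) =>
  nat_of_bool (i < r)%N)) => i j; case: (split_ordP i) => i' ->.
  by rewrite col_mxEu mxE /=; apply: linear_form_homog.
rewrite col_mxEd mxE /=.
by case: (_ == _); [apply: dhomog1 | apply: dhomog0].
Qed.

Lemma minor_formE I J y : form_at (minor_form I J) y =
  \det (col_mx (coord_mx (fun i => point_map y (vbasis {:A})`_(I i))) (select_mx k J)).
Proof.
rewrite form_atE /eval_form /minor_form -det_map_mx map_col_mx; congr (\det (col_mx _ _)).
  apply/matrixP => i j; rewrite !mxE; apply: eval_linear_form => c u v.
  by rewrite linearP add_lfunE scale_lfunE linearP.
by apply/matrixP => i j; rewrite !mxE rmorph_nat.
Qed.

(** At each y, [minor_kernel] shows that N_IJ(y) is the product of a factor depending on I and the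
    J-th minor of the quotient map. Factoring N over the polynomial ring then isolates the
    dependence on J as w_J. *)
Lemma pluecker_forms : exists d w, [/\ (d <= r)%N,
  forall J, w J \is d.-homog &
  forall y, exists2 nu, nu != 0 & forall J,
    \det (select_mx k J *m quot_mx y) = nu * form_at (w J) y].
Proof.
have Fker y (I : {ffun 'I_r -> 'I_(\dim {:A})}) : coord_mx (fun i =>
  point_map y (vbasis {:A})`_(I i)) *m quot_mx y = 0.
  rewrite coord_quot_mx; apply/matrixP => i j; rewrite !mxE quot_proj0 ?linear0//.
  by rewrite memv_img// memvf.
have minors y : exists mu kap I0, [/\ mu != 0, kap I0 = 1 &
    forall I J, mu * form_at (minor_form I J) y = kap I * \det (select_mx k J *m quot_mx
      y)].
  have [S0 S0Q] := quot_mx_linv y.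
  have span_y : (limg (point_map y) <=
      <<[seq point_map y (vbasis {:A})`_i | i : 'I_(\dim {:A}) <- enum 'I_(\dim
        {:A})]>>)%VS.
    apply/subvP => _ /memv_imgP[v _ ->]; rewrite (coord_vbasis (memvf v)) linear_lincomb.
    apply: memv_suml => i _; apply/rpredZ/memv_span; apply/mapP; exists i => //.
    by rewrite mem_enum.
  have := indep_selection span_y; rewrite rank_point_map => -[I0 iI0].
  have rf : row_free (coord_mx (fun i => point_map y (vbasis {:A})`_(finfun I0 i))).
    by apply: row_free_coord_mx => c c0; apply: iI0; rewrite -[RHS]c0;
      apply: eq_bigr => i _; rewrite ffunE.
  have [mu [kap [mu0 kap1] E]] := @minor_kernel _ _ _ _
    (fun I : {ffun 'I_r -> 'I_(\dim {:A})} => coord_mx (fun i =>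
      point_map y (vbasis {:A})`_(I i))) _ (finfun I0) S0 (Fker y) rf S0Q.
  by exists mu, kap, (finfun I0); split=> // I J; rewrite minor_formE E.
have [mu [kap [I0 [mu0 kap1 E]]]] := minors y0; have [J0 D0] := quot_mx_minor_neq0 y0.
have N0 : minor_form I0 J0 != 0.
  apply: contraNneq D0 => N0; have := E I0 J0; rewrite N0 kap1 mul1r => <-.
  by rewrite form_atE /eval_form meval0 mulr0.
(* The 2 x 2 minors are forms of degree 2r > 0 that vanish at every point, hence vanish as
   polynomials. *)
have rk1 I I' J J' : minor_form I J * minor_form I' J' = minor_form I J' * minor_form I' J.
  apply/eqP; rewrite -subr_eq0; apply/eqP; apply: (@form_eq0 _ _ (r + r)); last 1 first.
  - move=> y; have [mu' [kap' [_ [mu'0 _ E']]]] := minors y.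
    apply: (mulfI (mulf_neq0 mu'0 mu'0)); rewrite mulr0 form_atE /eval_form mevalB !mevalM.
    rewrite -![meval _ _]/(form_at _ y) mulrBr.
    have swap I1 J1 I2 J2 : mu' * mu' * (form_at (minor_form I1 J1) y * form_at
      (minor_form I2 J2) y) =
        kap' I1 * kap' I2 * (\det (select_mx k J1 *m quot_mx y) * \det (select_mx k J2 *m
          quot_mx y)).
      by rewrite mulrACA !E' mulrACA.
    rewrite !swap; ring.
  - by rewrite rpredB// dhomogM// minor_form_homog.
  - by rewrite addn_gt0 r_gt0.
have [u [w uw]] := rank1_factorization (@gcd_domain_mpoly k _) N0 rk1.
have [d [u' [w' [dr hw hu uw']]]] := homog_rank1_factorization N0 minor_form_homog uw.
(* With kap' I' = 1 the factor is mu' u'_I'(y); it is nonzero because some minor of the quotient map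
   at y is. *)
exists d, w'; split=> // y; have [mu' [kap' [I' [mu'0 kap'1 E']]]] := minors y.
have Ew J : \det (select_mx k J *m quot_mx y) = mu' * form_at (u' I') y * form_at (w' J) y.
  by rewrite -[LHS]mul1r -kap'1 -E' uw' form_atE eval_formM mulrA.
exists (mu' * form_at (u' I') y) => //.
have [J1] := quot_mx_minor_neq0 y; rewrite Ew; apply: contraNneq => ->.
by rewrite mul0r.
Qed.

End PlueckerForms.

End ConstantRank.

(** * The degree of O(d) is an isomorphism invariant *)

Section Families.
Variables (k : closedFieldType) (V : vectType k).

Lemma isomorphic_sym (E F : Defs.family V) : isomorphic E F -> isomorphic F E.
Proof. by move=> [phi [psi [? ? ? ?]]]; exists psi, phi. Qed.

Lemma isomorphic_trans (E F G : Defs.family V) : isomorphic E F -> isomorphic F G ->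
  isomorphic E G.
Proof.
move=> [f [f' [mf mf' fK f'K]]] [g [g' [mg mg' gK g'K]]].
exists (fun x => (g x \o f x)%VF), (fun x => (f' x \o g' x)%VF); split.
- move=> s x /mf/mg; congr reg; apply: functional_extensionality_dep =>  y.
  by rewrite comp_lfunE.
- move=> s x /mg'/mf'; congr reg; apply: functional_extensionality_dep =>  y.
  by rewrite comp_lfunE.
- by move=> x u; rewrite !comp_lfunE gK fK.
- by move=> x u; rewrite !comp_lfunE f'K g'K.
Qed.

Lemma hom_regularE (g : 'Hom(k^o, k^o)) (c : k) : g c = c * (g 1 : k) :> k.
Proof. by have -> : c = c *: (1 : k^o) by [rewrite [RHS]mulr1];
  rewrite linearZ [X in _ = X * _]mulr1. Qed.

Lemma reg_O (d : int) (f : pspace V -> k) x :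
  @reg k V (O_ V d) f x <-> regular d f x.
Proof.
split=> [h|rf l].
  have := h \1%VF; apply: regular_ext => y.
  by rewrite id_lfunE.
apply: regular_ext (regular0M (regular_cst (l 1) x) rf) => y.
by rewrite (hom_regularE l (f y)) mulrC.
Qed.

(** The isomorphism multiplies the fibre at x by a scalar phi x != 0. Evaluating it on a local
    generator of O(d) shows that phi is regular of degree d' - d. *)
Lemma isomorphic_O_eq (d d' : int) : (1 < \dim {:V})%N ->
  isomorphic (O_ V d) (O_ V d') -> d = d'.
Proof.
move=> dim2 [f [g [mf mg fK gK]]].
pose phi x : k := f x 1.
have fE x (c : k) : f x c = c * phi x by apply: hom_regularE.
apply/esym/eqP; rewrite -subr_eq0; apply/eqP.
apply: (@nonvanishing_regular_degree _ _ _ phi dim2) => [x|x]; last first.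
  by apply/eqP => e; have := fK x 1; rewrite fE e mulr0 linear0 => /esym/eqP;
    rewrite oner_eq0.
have [h [rh hx]] := unit_regular d x.
have /reg_O rfh := mf _ _ ((reg_O _ _ _).2 rh).
apply: regular_eq (regularM rfh (regularV rh hx)).
by apply: near_ptS (regular_neq0 rh hx) => y hy; rewrite fE mulrAC divff ?mul1r.
Qed.

Lemma c1_eq (E : Defs.family V) (d : int) : (1 < \dim {:V})%N ->
  isomorphic (det_family E) (O_ V d) -> c1 E = d.
Proof.
move=> dim2 iso; apply: xget_unique => // d' iso'.
exact: (isomorphic_O_eq dim2 (isomorphic_trans (isomorphic_sym iso') iso)).
Qed.

End Families.

Section CokerDeterminant.
Variables (k : closedFieldType) (A B : vectType k) (M : {vspace 'Hom(A, B)}) (r m : nat).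
Hypothesis rankM : constant_rank M r.
Hypothesis dimB : \dim {:B} = (r + m)%N.
Local Notation V := (subvs_of M).
Local Notation quot y := (quot_proj (limg (point_map y))).
Implicit Types (x y : pspace V).

Lemma reg_coker (t : Defs.section (coker_bundle M)) x :
  reg t x -> exists2 s : pspace V -> B, regvec 0 s x & near_pt x (fun y =>
    t y = quot y (s y)).
Proof.
case=> n [c [u [cu tE]]].
have /choice[s sE] : forall i, exists s : pspace V -> B,
    regvec 0 s x /\ forall y, u i y = quot y (s y).
  by move=> i; have [_ [s rs us]] := cu i; exists s.
exists (fun y => \sum_i c i y *: s i y).
  by apply: regvec_sum => i; apply: (regvec_scale (cu i).1 (sE i).1).
apply: near_ptS tE => y ->; rewrite linear_sum; apply: eq_bigr => i _.
by rewrite (sE i).2 linearZ.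
Qed.

Lemma reg_coker_quot (s : pspace V -> B) x : regvec 0 s x ->
  @reg k V (coker_bundle M) (fun y => quot y (s y)) x.
Proof.
move=> rs; exists 1%N, (fun _ _ => 1), (fun _ y => quot y (s y)); split=> [i|].
  by split; [apply: regular_cst | exists s].
by apply: near_ptS (near_ptT x) => y _; rewrite big_ord1 scale1r.
Qed.

Lemma det_cast (n n' : nat) (enn : n = n') (f : nat -> 'I_n' -> k) :
  \det (\matrix_(i, j < n') f i j) = \det (\matrix_(i, j < n) f i (cast_ord enn j)).
Proof. by subst n'; congr (\det _); apply/matrixP => i j; rewrite !mxE cast_ord_id. Qed.

Variables (e : 'I_(r + m) -> B) (l : 'I_(r + m) -> 'Hom(B, k^o)).
Hypothesis le : forall i j, l i (e j) = (i == j)%:R.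
Hypothesis eE : forall u, u = \sum_i l i u *: e i.
Variables (d : nat) (w : {ffun 'I_m -> 'I_(r + m)} -> {mpoly k[\dim {:V}]}).
Variable nu : pspace V -> k.
Hypothesis w_homog : forall J, w J \is d.-homog.
Hypothesis nu_neq0 : forall y, nu y != 0.
Hypothesis nuE : forall y J,
  \det (select_mx k J *m quot_mx rankM dimB e y) = nu y * form_at (w J) y.

(** Up to [nu], the wedge of the classes of m vectors of B is polynomial in the point: the sum is
    the map from the exterior power of B to O(d) defined by the w_J. *)
Lemma det_quot y (s : nat -> B) :
  \det (\matrix_(i, j < \dim {:subvs_of (limg (point_map y))^C}) coord (vbasis {:subvs_of
    (limg (point_map y))^C}) j (quot y (s i)))
  = nu y * \sum_(J : {ffun 'I_m ->
    'I_(r + m)}) (\prod_(i < m) l (J i) (s i)) * form_at (w J) y.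
Proof.
rewrite (det_cast (dim_quot rankM dimB y) (fun i j => coord _ j (quot y (s i)))).
rewrite -(coord_quot_mx rankM dimB eE (fun i : 'I_m => s i)) det_mulmx_expand mulr_sumr.
apply: eq_bigr => J _; rewrite -select_quot_mx nuE mulrCA; congr (_ * (_ * _)).
by apply: eq_bigr => i _; rewrite mxE.
Qed.

(** The isomorphism is multiplication by 1 / nu: it turns the wedges of regular sections, as
    computed by [det_quot], into regular functions of degree d, although nu itself has no
    regularity. *)
Lemma det_coker_iso : isomorphic (det_family (coker_bundle M)) (O_ V d%:Z).
Proof.
have w_neq0 x : exists J, form_at (w J) x != 0.
  have [J] := quot_mx_minor_neq0 rankM dimB eE x; rewrite nuE => wJ.
  by exists J; apply: contraNneq wJ => ->; rewrite mulr0.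
exists (fun y => ((nu y)^-1 *: \1%VF)), (fun y => nu y *: \1%VF); split.
- move=> s x [n [c [D [cD sE]]]]; apply/reg_O.
  have rD i : regular d%:Z (fun y => (nu y)^-1 * D i y) x.
    have [_ [t rt DE]] := cD i.
    have /choice[u uE] : forall a, exists u, regvec 0 u x /\ near_pt x (fun y =>
      t a y = quot y (u y)).
      by move=> a; have [u] := reg_coker (rt a); exists u.
    have near_t : near_pt x (fun y => forall a : 'I_m, t a y = quot y (u a y)).
      by apply: near_pt_all => a; apply: (uE a).2.
    have rS : regular d%:Z (fun y =>
      \sum_(J : {ffun 'I_m -> 'I_(r + m)}) (\prod_(i < m) l (J i) (u i y)) * form_at (w
        J) y) x.
      apply: regular_sum => J; apply: regular0M; last exact: regular_form.
      by apply: regular0_prod => a; apply: (uE a).1.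
    apply: regular_eq rS; apply: near_ptS near_t => y ty.
    rewrite DE -[LHS](mulKf (nu_neq0 y)) -(det_quot y (fun a => u a y)); congr (_ * \det _).
    apply/matrixP => a b; rewrite !mxE.
    have am : (a < m)%N by rewrite (dim_quot rankM dimB y) ltn_ord.
    by rewrite (ty (Ordinal am)).
  have := regular_sum (fun i => regular0M (cD i).1 (rD i)).
  apply: regular_eq; apply: near_ptS sE => y ->.
  rewrite scale_lfunE id_lfunE scaler_sumr; apply: eq_bigr => i _.
  by rewrite mulrCA.
(* Near a point where w_J is nonzero, the classes of the e_(J a) have determinant D = nu w_J, so nu
   f is the regular multiple f / w_J of D. *)
- move=> f x /reg_O rf; have [J wJ] := w_neq0 x.
  pose t (i : nat) y := quot y (nth 0 [seq e (J a) | a <- enum 'I_m] i).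
  pose D y := nu y * form_at (w J) y.
  exists 1%N, (fun _ y => f y / form_at (w J) y), (fun _ => D); split=> [_|].
    split.
      rewrite -(subrr d%:Z); apply: regularM rf _.
      by apply: regularV => //; apply: regular_form.
    exists t => [i|y]; first by apply: reg_coker_quot; apply: regvec_cst.
    rewrite (det_quot y (nth 0 [seq e (J a) | a <- enum 'I_m])); congr (_ * _);
      rewrite (bigD1 J)//= [X in _ + X]big1 ?addr0 => [|J' /eqP JJ'].
      by rewrite big1 ?mul1r// => i _; rewrite nth_enum_map le eqxx.
    have [i Ji] : exists i, J' i != J i.
      by apply: contrapT => /forallNP h; apply: JJ'; apply/ffunP => i;
        apply/eqP/negPn/negP/h.
    by rewrite (bigD1 i)//= nth_enum_map le (negbTE Ji) !mul0r.
  have := regular_neq0 (regular_form x (w_homog J)) wJ.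
  apply: near_ptS => y wy; rewrite big_ord1 scale_lfunE id_lfunE /D.
  by rewrite -[_ *: _]/(_ * _) -[X in _ = X]/(_ * _) mulrCA divfK// mulrC.
- by move=> x u; rewrite !scale_lfunE !id_lfunE scalerA divff ?scale1r.
- by move=> x u; rewrite !scale_lfunE !id_lfunE scalerA mulVf ?scale1r.
Qed.

End CokerDeterminant.

(** * The image bundle *)

Section HomFamilies.
Variables (k : closedFieldType) (V A B : vectType k) (g : V -> 'Hom(A, B)).
Hypothesis g_lin : linear g.
Implicit Types (x y : pspace V).

(** In a basis of A, the coefficients f (g (rep y) (e i)) are linear forms in [rep y], which
    accounts for the degree 1. A general linear g covers both P(M) and its lines. *)
Lemma regvec_hom j (s : pspace V -> A) x : regvec j s x ->
  regvec (1 + j) (fun y => g (rep y) (s y)) x.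
Proof.
move=> rs f; have [e [l [_ eE]]] := dual_basis (erefl (\dim {:A})).
have rE : regular (1 + j) (fun y => \sum_i f (g (rep y) (e i)) * l i (s y)) x.
  apply: regular_sum => i; apply: regularM (rs (l i)).
  apply: (@regular_lin _ _ (fun w => f (g w (e i)))) => c u v.
  by rewrite g_lin add_lfunE scale_lfunE linearP.
apply: regular_ext rE => y; rewrite [in RHS](eE (s y)) linear_sum linear_sum.
by apply: eq_bigr => i _; rewrite !linearZ mulrC.
Qed.

(** Preimages of a basis of the image at x, multiplied by a local generator of O(-1). Independence
    near x then follows by openness. *)
Lemma local_frame r x : \dim (limg (g (rep x))) = r ->
  exists s : 'I_r -> pspace V -> A, (forall i, near_pt x (regvec (-1) (s i))) /\
    indep (fun i => g (rep x) (s i x)).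
Proof.
move=> rk.
have /choice[a aE] : forall i : 'I_r, exists a,
  g (rep x) a = (vbasis (limg (g (rep x))))`_i.
  move=> i; have : (vbasis (limg (g (rep x))))`_i \in limg (g (rep x)).
    by apply: vbasis_mem; rewrite mem_nth// size_tuple rk.
  by case/memv_imgP => a _ ->; exists a.
have [h [rh hx]] := unit_regular (-1) x.
exists (fun i y => h y *: a i); split=> [i|].
  apply: near_ptS (regular_near rh) => y rhy; rewrite -[-1]addr0.
  exact: regvec_scale rhy (regvec_cst _ _).
have ia : indep (fun i => g (rep x) (a i)).
  apply/freeP_indep; have := basis_free (vbasisP (limg (g (rep x)))).
  congr (free _); apply: (@eq_from_nth _ 0);
    first by rewrite size_map size_enum_ord size_tuple.
  move=> i; rewrite size_tuple => lti0; have lti : (i < r)%N by rewrite -rk.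
  by rewrite -[i]/(nat_of_ord (Ordinal lti)) nth_enum_map aE.
move=> c c0 i; apply: (mulIf hx); rewrite mul0r.
apply: (ia (fun i => c i * h x)); rewrite -[RHS]c0; apply: eq_bigr => j _.
by rewrite linearZ scalerA.
Qed.

End HomFamilies.

Section ImageBundle.
Variables (k : closedFieldType) (A B : vectType k) (M : {vspace 'Hom(A, B)}).
Local Notation V := (subvs_of M).
Implicit Types (x y : pspace V).

Lemma point_map_linear : linear (vsval : V -> 'Hom(A, B)).
Proof. exact: vsval_is_linear. Qed.

Lemma regvec_point_map j (s : pspace V -> A) x : regvec j s x ->
  regvec (1 + j) (fun y => point_map y (s y)) x.
Proof. exact: (regvec_hom point_map_linear). Qed.

Definition image_section (s : pspace V -> A) : Defs.section (image_bundle M) :=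
  fun y => vsproj (limg (point_map y)) (point_map y (s y)).

Lemma vsval_image_section s y : vsval (image_section s y) = point_map y (s y).
Proof. by rewrite vsprojK// memv_img// memvf. Qed.

Lemma reg_image_section s x : regvec (-1) s x -> reg (image_section s) x.
Proof.
move=> rs; exists 1%N, (fun _ _ => 1), (fun _ => image_section s); split=> [i|].
  by split; [apply: regular_cst | exists s].
by apply: near_ptS (near_ptT x) => y _; rewrite big_ord1 scale1r.
Qed.

Lemma reg_image (t : Defs.section (image_bundle M)) x : reg t x ->
  exists2 s : pspace V -> B, regvec 0 s x & near_pt x (fun y => vsval (t y) = s y).
Proof.
case=> n [c [u [cu tE]]].
have /choice[s sE] : forall i, exists s : pspace V -> A,
    regvec (-1) s x /\ forall y, u i y = image_section s y.
  by move=> i; have [_ [s rs us]] := cu i; exists s.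
exists (fun y => \sum_i c i y *: point_map y (s i y)).
  by apply: regvec_sum => i; apply: (regvec_scale (cu i).1 (regvec_point_map (sE i).1)).
apply: near_ptS tE => y ->; rewrite linear_sum; apply: eq_bigr => i _.
rewrite linearZ (sE i).2; exact: (congr1 ( *:%R (c i y)) (vsval_image_section _ _)).
Qed.

(** The frame stays independent near x, and constant rank forces it to remain a basis of the image
    there; Cramer's rule makes the coordinates regular. *)
Lemma vector_bundle_image r : constant_rank M r -> vector_bundle r (image_bundle M).
Proof.
move=> rankM x; have [s [rs ind_s]] := local_frame (rank_point_map rankM x).
exists (fun i => image_section (s i)).
have rE i : regvec 0 (fun y => point_map y (s i y)) x.
  exact: (regvec_point_map (near_pt_self (rs i))).
have near_ind := regvec_near_indep rE ind_s.
apply: near_ptS (near_ptI (near_pt_all rs) (near_pt_near near_ind)) => y [rsy near_indy].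
have iy := near_pt_self near_indy.
split.
  apply: indep_basis => [c c0 i|i|]; last 2 first.
  - exact: memvf.
  - by rewrite dimvf; apply: (rank_point_map rankM y).
  apply: iy i; have /(congr1 vsval) := c0; rewrite linear0 linear_sum => e.
  rewrite -[RHS]e; apply: eq_bigr => i _; rewrite linearZ.
  exact: (congr1 ( *:%R (c i)) (esym (vsval_image_section _ _))).
move=> t; split=> [/reg_image[v rv tE]|[c [rc tE]]]; last first.
  exists r, c, (fun i => image_section (s i)); split=> // i; split=> //.
  by exists (s i) => //; apply: (rsy i).
(* Coordinates are chosen point by point, with the default 0 where the frame degenerates, which does
   not happen near y. *)
have /choice[c cE] : forall z, exists c : 'I_r -> k, indep (fun i => point_map z (s i z)) ->
    vsval (t z) = \sum_i c i *: point_map z (s i z).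
  move=> z; have [iz|] := pselect (indep (fun i => point_map z (s i z)));
    last by exists (fun=> 0).
  have [|c cE] := indep_span iz _ (rank_point_map rankM z) (subvsP (t z)).
    by move=> i; rewrite memv_img// memvf.
  by exists c.
exists (fun i z => c z i); split; last first.
  apply: near_ptS near_indy => z /cE tz; apply: subvs_inj; rewrite tz linear_sum.
  apply: eq_bigr => i _; rewrite linearZ.
  exact: (congr1 ( *:%R (c z i)) (esym (vsval_image_section _ _))).
apply: (regular_coords (v := v) (e := fun i z => point_map z (s i z))) => //.
  by move=> i; exact: (regvec_point_map (rsy i)).
by apply: near_ptS (near_ptI tE near_indy) => z [<- /cE].
Qed.

End ImageBundle.

(** A subspace of largest dimension inside P absorbs every v in P, as adding the line of v stays
    inside P. This gives access to the intersection of infinitely many images. *)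
Lemma vspace_of_pred (K : fieldType) (U : vectType K) (P : U -> Prop) : P 0 ->
  (forall c u v, P u -> P v -> P (c *: u + v)) ->
    exists W : {vspace U}, forall v, v \in W <-> P v.
Proof.
move=> P0 PD; pose good d :=
  `[< exists2 W : {vspace U}, \dim W = d & forall v, v \in W -> P v >].
have ex : exists d, good d.
  by exists 0%N; apply/asboolP; exists 0%VS; rewrite ?dimv0// => v; rewrite memv0 => /eqP->.
have bound d : good d -> (d <= \dim {:U})%N.
  by move=> /asboolP[W <- _]; apply/dimvS/subvf.
case: (ex_maxnP ex bound) => d /asboolP[W Wd WP] dmax; exists W => v; split;
  first exact: WP.
move=> Pv; have /dmax : good (\dim (W + <[v]>)).
  apply/asboolP; exists (W + <[v]>)%VS => // _ /memv_addP[u uW [_ /vlineP[c ->] ->]].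
  by rewrite addrC; apply: PD => //; apply: WP.
rewrite -Wd => le; suff /eqP -> : W == (W + <[v]>)%VS
  by rewrite (subvP (addvSr _ _))// memv_line.
by rewrite eqEdim le andbT addvSl.
Qed.

(** * Splitting along a line *)

Section Line.
Variables (k : closedFieldType) (A B : vectType k) (M : {vspace 'Hom(A, B)}) (r : nat).
Hypothesis rankM : constant_rank M r.
Variable L : {vspace subvs_of M}.
Hypothesis dimL : \dim L = 2.
Local Notation W := (subvs_of L).
Local Notation incl := (@pspace_incl k (subvs_of M) L).
Implicit Types (x y z : pspace W).

Definition line_hom (w : W) : 'Hom(A, B) := vsval (vsval w).

Lemma line_hom_linear : linear line_hom.
Proof. by move=> c u v; rewrite /line_hom !linearP. Qed.

Definition line_map y : 'Hom(A, B) := line_hom (rep y).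

Lemma point_map_incl y : exists2 c, c != 0 & forall v,
  point_map (incl y) v = c *: line_map y v.
Proof.
have [c c0 e] := rep_incl y; exists c => // v.
by rewrite /point_map e linearZ scale_lfunE.
Qed.

Lemma limg_incl y : limg (point_map (incl y)) = limg (line_map y).
Proof.
have [c c0 e] := point_map_incl y; apply/vspaceP => v;
  apply/memv_imgP/memv_imgP => -[u _ ->].
  by exists (c *: u); rewrite ?memvf// e linearZ.
by exists (c^-1 *: u); rewrite ?memvf// e linearZ scalerA divff// scale1r.
Qed.

Lemma rank_line_map y : \dim (limg (line_map y)) = r.
Proof. by rewrite -limg_incl (rank_point_map rankM). Qed.

Lemma line_dim2 : \dim {:W} = 2.
Proof. by rewrite dimvf. Qed.

Lemma rep_line_span x y z : z <> x -> exists c d, rep y = c *: rep x + d *: rep z.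
Proof.
move=> zx; have zxl : rep z \notin <[rep x]>%VS by apply/negP => /rep_eq.
have full : <<[:: rep z; rep x]>>%VS = {:W}%VS.
  apply/eqP; rewrite eqEdim subvf line_dim2.
  have : free [:: rep z; rep x] by rewrite free_cons span_seq1 zxl seq1_free rep_neq0.
  by move/eqP => ->.
have : rep y \in <<[:: rep z; rep x]>>%VS by rewrite full memvf.
rewrite span_cons span_seq1 => /memv_addP[_ /vlineP[d ->] [_ /vlineP[c ->] ->]].
by exists c, d; rewrite addrC.
Qed.

(* Otherwise b and a local frame of the image at x would remain independent at
   nearby points z, where they all lie in a space of dimension r. *)
Lemma limg_line_closed x (b : B) : (forall z, z <> x -> b \in limg (line_map z)) ->
  b \in limg (line_map x).
Proof.
move=> bz; apply/negPn/negP => bx.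
have [s [rs ind_s]] := local_frame (rank_line_map x).
pose e (i : 'I_r.+1) y := if unlift ord0 i is Some j then line_map y (s j y) else b.
have re i : regvec 0 (e i) x.
  rewrite /e; case: (unlift ord0 i) => [j|]; last exact: regvec_cst.
  exact: (regvec_hom line_hom_linear (near_pt_self (rs j))).
have ie : indep (fun i => e i x).
  move=> c; rewrite big_ord_recl {1}/e unlift_none => ce.
  have sumE : \sum_(i < r) c (lift ord0 i) *: e (lift ord0 i) x =
      \sum_(i < r) c (lift ord0 i) *: line_map x (s i x).
    by apply: eq_bigr => i _; rewrite /e liftK.
  rewrite sumE in ce.
  have c0 : c ord0 = 0.
    apply/eqP; apply: contraNT bx => c0; rewrite -[b](scalerK c0).
    apply: rpredZ; move/eqP: ce; rewrite addr_eq0 => /eqP->; rewrite rpredN.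
    by apply: memv_suml => i _; rewrite memvZ// memv_img// memvf.
  rewrite c0 scale0r add0r in ce; have := ind_s _ ce => ci i.
  by case: (unliftP ord0 i) => [j ->|->].
have d2 : (1 < \dim {:W})%N by rewrite line_dim2.
have [z zx iz] := near_pt_other d2 (regvec_near_indep re ie).
have := indep_dim (W := limg (line_map z)) iz; rewrite rank_line_map ltnn => /(_ _)/notF;
  apply.
move=> i; rewrite /e; case: (unlift ord0 i) => [j|]; last exact: bz.
by rewrite memv_img// memvf.
Qed.

(** The basis f(a'_i), b'_i of the overview as one sequence: p vectors linear in the point, then
    constant ones. *)
Definition line_frame (p : nat) (a : nat -> A) (b : nat -> B) y (i : nat) : B :=
  if (i < p)%N then line_map y (a i) else b (i - p)%N.

Lemma line_splitting : exists p a b, (p <= r)%N /\ forall y,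
  indep (fun i : 'I_r => line_frame p a b y i) /\
  forall i, line_frame p a b y i \in limg (line_map y).
Proof.
have [C CE] := @vspace_of_pred _ B (fun b => forall y, b \in limg (line_map y))
  (fun y => mem0v _) (fun c u v hu hv y => rpredD (rpredZ c (hu y)) (hv y)).
(* For z != x, [rep y] is a combination of [rep x] and [rep z], and both maps send v into the image
   at z, the first one because its value lies in [C]. The point z = x is left to
   [limg_line_closed]. *)
have key x v : line_map x v \in C -> forall y, line_map y v \in C.
  move=> /CE vx y; apply/CE.
  have main z : z <> x -> line_map y v \in limg (line_map z).
    move=> zx; have [c [d e]] := rep_line_span y zx.
    rewrite /line_map e /line_hom !linearD !linearZ /= add_lfunE !scale_lfunE.
    by rewrite rpredD// rpredZ ?memv_img ?memvf//; apply: vx.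
  move=> z; have [->|zx] := pselect (z = x); last exact: main.
  exact: limg_line_closed.
have [x0 _] : exists x0 : pspace W, True.
  have : vpick {:W} != 0 by rewrite vpick0 -dimv_eq0 line_dim2.
  by case/pspace_pt => x0 _; exists x0.
pose A2 := (line_map x0 @^-1: C)%VS.
have A2E y v : (line_map y v \in C) = (v \in A2).
  by rewrite -memv_preim; apply/idP/idP => /key; apply.
pose A1 := (A2^C)%VS.
have ind y : indep (fun i : 'I_(\dim A1 + \dim C) =>
    line_frame (\dim A1) (nth 0 (vbasis A1)) (nth 0 (vbasis C)) y i).
  move=> c; rewrite big_split_ord /=.
  have -> : \sum_(i < \dim A1) c (lshift (\dim C) i) *: line_frame (\dim A1)
      (nth 0 (vbasis A1)) (nth 0 (vbasis C)) y i =
      line_map y (\sum_(i < \dim A1) c (lshift (\dim C) i) *: (vbasis A1)`_i).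
    by rewrite linear_lincomb; apply: eq_bigr => i _; rewrite /line_frame ltn_ord.
  have -> : \sum_(i < \dim C) c (rshift (\dim A1) i) *: line_frame (\dim A1)
      (nth 0 (vbasis A1)) (nth 0 (vbasis C)) y (\dim A1 + i) =
      \sum_(i < \dim C) c (rshift (\dim A1) i) *: (vbasis C)`_i.
    by apply: eq_bigr => i _; rewrite /line_frame ltnNge leq_addr addKn.
  set v := \sum_i _; set b := \sum_i _ => vb.
  have bC : b \in C.
    by apply: memv_suml => i _; apply/memvZ/vbasis_mem/mem_nth; rewrite size_tuple.
  have v1 : v \in A1.
    by apply: memv_suml => i _; apply/memvZ/vbasis_mem/mem_nth; rewrite size_tuple.
  have v2 : v \in A2.
    by rewrite -(A2E y); move/eqP: vb; rewrite addr_eq0 => /eqP->; rewrite rpredN.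
  have v0 : v = 0 by apply/eqP; rewrite -memv0 -(capv_compl A2) memv_cap v1 v2.
  have b0 : b = 0 by move: vb; rewrite v0 linear0 add0r.
  move=> i; case: (split_ordP i) => j ->.
    exact: (elimT (@freeP _ _ _ (vbasis A1)) (basis_free (vbasisP A1)) (fun j =>
      c (lshift _ j)) v0).
  exact: (elimT (@freeP _ _ _ (vbasis C)) (basis_free (vbasisP C)) (fun j =>
    c (rshift _ j)) b0).
have inI y i : line_frame (\dim A1) (nth 0 (vbasis A1)) (nth 0 (vbasis C)) y i \in limg
  (line_map y).
  rewrite /line_frame; case: ltnP => _; first by rewrite memv_img// memvf.
  have : (vbasis C)`_(i - \dim A1) \in C; last by move/CE.
  have [lt|ge] := ltnP (i - \dim A1) (\dim C);
    first by rewrite vbasis_mem// mem_nth// size_tuple.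
  by rewrite nth_default ?mem0v// size_tuple.
(* Independence bounds the sum by r. Conversely, the image at [x0] lies in the image of [A1] plus
   [C], because A = A1 + A2 and [A2] is sent into [C]. *)
have dimr : (\dim A1 + \dim C)%N = r.
  apply/eqP; rewrite eqn_leq -{1}(rank_line_map x0) (indep_dim (ind x0))//=.
  rewrite -{1}(rank_line_map x0); apply: (@leq_trans (\dim (line_map x0 @: A1 + C))).
    apply/dimvS/subvP => _ /memv_imgP[v _ ->].
    have : v \in (A1 + A2)%VS by rewrite addvC addv_complf memvf.
    case/memv_addP => v1 v1A [v2 v2A ->]; rewrite linearD memv_add ?memv_img//.
    by rewrite A2E.
  apply: leq_trans (dimv_add_leqif _ _).1 _; rewrite leq_add2r.
  by have := limg_ker_dim (line_map x0) A1 => <-; apply: leq_addl.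
exists (\dim A1), (nth 0 (vbasis A1)), (nth 0 (vbasis C)); split;
  first by rewrite -dimr leq_addr.
by move=> y; split=> //; rewrite -dimr.
Qed.

End Line.

Lemma linfunE (K : fieldType) (U W : vectType K) (f : U -> W) : linear f -> linfun f =1 f.
Proof.
move=> lin; pose g : {linear U -> W} := HB.pack f (GRing.isLinear.Build K U W *:%R f lin).
exact: (lfunE g).
Qed.

Section LineSplitting.
Variables (k : closedFieldType) (A B : vectType k) (M : {vspace 'Hom(A, B)}) (r : nat).
Hypothesis rankM : constant_rank M r.
Variable L : {vspace subvs_of M}.
Local Notation W := (subvs_of L).
Local Notation incl := (@pspace_incl k (subvs_of M) L).
Implicit Types (x y : pspace W).
Variables (p : nat) (a : nat -> A) (b : nat -> B).
Hypothesis p_le : (p <= r)%N.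
Local Notation frame := (@line_frame k A B M L p a b).
Hypothesis frame_indep : forall y, indep (fun i : 'I_r => frame y i).
Hypothesis frame_limg : forall y i, frame y i \in limg (line_map y).

(** The opposite of the degree of the i-th frame vector, hence the degree of the corresponding
    coordinate of a vector of degree 0. *)
Definition twist (i : nat) : int := if (i < p)%N then -1 else 0.

Lemma regvec_line_frame i x : regvec (- twist i) (fun y => frame y i) x.
Proof.
rewrite /twist /line_frame; case: ltnP => _; last first.
  by rewrite oppr0; apply: regvec_cst.
rewrite opprK -[1]addr0.
exact: (regvec_hom (@line_hom_linear _ _ _ _ L) (regvec_cst (a i) x)).
Qed.

(** Multiplying each frame vector by a local generator of O(twist i) gives a frame of degree 0, to
    which Cramer's rule applies. *)
Lemma regular_frame_coords n (v : pspace W -> B) (c : 'I_n -> pspace W -> k) x :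
  n = r -> regvec 0 v x -> near_pt x (fun y => v y = \sum_i c i y *: frame y i) ->
  forall i : 'I_n, regular (twist i) (c i) x.
Proof.
move=> nr rv vE; subst n.
have /choice[h hE] : forall i : 'I_r, exists h, regular (twist i) h x /\ h x != 0.
  by move=> i; apply: unit_regular.
have re i : regvec 0 (fun y => h i y *: frame y i) x.
  by rewrite -(subrr (twist i)); apply: regvec_scale (hE i).1 (regvec_line_frame i x).
have ie : indep (fun i => h i x *: frame x i).
  move=> u u0 i; apply: (mulIf (hE i).2); rewrite mul0r.
  apply: (frame_indep (y := x) (c := fun i => u i * h i x)); rewrite -[RHS]u0.
  by apply: eq_bigr => j _; rewrite scalerA.
have hn : near_pt x (fun y => forall i, h i y != 0).
  by apply: near_pt_all => i; apply: regular_neq0 (hE i).1 (hE i).2.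
have rq : forall i, regular 0 (fun y => c i y / h i y) x.
  apply: (regular_coords re rv ie); apply: near_ptS (near_ptI hn vE) => y [hy ->].
  by apply: eq_bigr => i _; rewrite scalerA divfK.
move=> i; apply: regular_eq (regular0M (rq i) (hE i).1).
by apply: near_ptS hn => y hy; rewrite divfK.
Qed.

Definition twists : seq int := nseq p (-1) ++ nseq (r - p) 0.

Lemma size_twists : size twists = r.
Proof. by rewrite size_cat !size_nseq subnKC. Qed.

Lemma nth_twists (i : nat) : twists`_i = twist i.
Proof. by rewrite nth_cat size_nseq !nth_nseq /twist; case: (i < p)%N => //; case: ifP. Qed.

Definition frame_comb y (v : 'rV[k]_(size twists)) : subvs_of (limg (point_map (incl y))) :=
  vsproj (limg (point_map (incl y))) (\sum_i v 0 i *: frame y i).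

Lemma frame_comb_linear y : linear (frame_comb y).
Proof.
move=> c u v; rewrite /frame_comb -linearP; congr (vsproj _ _).
rewrite scaler_sumr -big_split; apply: eq_bigr => i _.
by rewrite !mxE scalerDl scalerA.
Qed.

Definition frame_map y := linfun (frame_comb y).

Lemma frame_mapE y v : vsval (frame_map y v) = \sum_i v 0 i *: frame y i.
Proof.
rewrite /frame_map (linfunE (frame_comb_linear y)) vsprojK//.
by apply: memv_suml => i _; rewrite memvZ// limg_incl.
Qed.

Lemma frame_indep_twists y : indep (fun i : 'I_(size twists) => frame y i).
Proof. by rewrite size_twists. Qed.

Lemma frame_map_inj y : lker (frame_map y) == 0%VS.
Proof.
apply/lker0P => u v /(congr1 vsval); rewrite !frame_mapE => e.
by apply/rowP => i; have := indep_inj (frame_indep_twists (y := y)) e i.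
Qed.

Lemma frame_mapK y : cancel (frame_map y) (frame_map y)^-1%VF.
Proof. exact: lker0_lfunK (frame_map_inj y). Qed.

Lemma frame_mapVK y : cancel (frame_map y)^-1%VF (frame_map y).
Proof.
move=> u; apply: limg_lfunVK.
have uI : vsval u \in limg (line_map y).
  by have := subvsP u; move: (vsval u) => w; rewrite limg_incl.
have [c uE] := indep_span (frame_indep_twists (y := y)) (fun i => frame_limg y i)
  (etrans (rank_line_map rankM y) (esym size_twists)) uI.
apply/memv_imgP; exists (\row_i c i); first exact: memvf.
apply: subvs_inj; rewrite frame_mapE uE; apply: eq_bigr => i _.
by rewrite mxE.
Qed.

Lemma restriction_iso : isomorphic (restriction L (image_bundle M)) (sumO W twists).
Proof.
exists (fun y => (frame_map y)^-1%VF), frame_map; split; last 2 first.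
- exact: frame_mapVK.
- exact: frame_mapK.
(* Seen in B, a section of the restriction is near x a combination of pullbacks of regular vectors,
   so its coordinates in the frame are regular of the right degrees. *)
- move=> u x [n [c [t [ct uE]]]].
  have /choice[s sE] : forall j, exists s : pspace (subvs_of M) -> B, regvec 0 s (incl x) /\
      near_pt x (fun y => vsval (t j y) = s (incl y)).
    move=> j; have [_ [S rS tS]] := ct j; have [s rs SE] := reg_image rS.
    by exists s; split=> //; apply: near_ptS (near_pt_incl SE) => y; rewrite tS.
  pose v y := \sum_j c j y *: s j (incl y).
  have rv : regvec 0 v x.
    apply: regvec_sum => j.
    have rs : regvec 0 (fun y => s j (incl y)) x.
      by move=> l; exact: (regular_incl (f := fun z => l (s j z)) ((sE j).1 l)).
    exact: (regvec_scale (ct j).1 rs).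
  have vE : near_pt x (fun y => vsval (u y) = v y).
    have := near_pt_all (fun j => (sE j).2); move=> /(near_ptI uE).
    apply: near_ptS => y [-> tE]; rewrite linear_sum; apply: eq_bigr => j _.
    by rewrite linearZ; exact: (congr1 ( *:%R (c j y)) (tE j)).
  have expand y : vsval (u y) = \sum_i ((frame_map y)^-1%VF (u y)) 0 i *: frame y i.
    by rewrite -frame_mapE frame_mapVK.
  move=> i; rewrite nth_twists.
  move: i; apply: (regular_frame_coords size_twists rv).
  by apply: near_ptS vE => y <-; apply: expand.
- move=> v x rv.
  (* The constant vectors b i lie in the image only along L, so they have to be
     written in a frame of sections defined on the whole space. *)
  pose vB y := \sum_i v y 0 i *: frame y i.
  have rvB : regvec 0 vB x.
    apply: regvec_sum => i; rewrite -(subrr (twist i)).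
    apply: regvec_scale (regvec_line_frame i x).
    by rewrite -nth_twists; apply: rv.
  have [s [rs ind_s]] := local_frame (rank_point_map rankM (incl x)).
  pose e i y := point_map (incl y) (s i (incl y)).
  have re i : regvec 0 (e i) x.
    move=> l; apply: (regular_incl (f := fun z => l (point_map z (s i z)))).
    exact: (regvec_point_map (near_pt_self (rs i))).
  have near_ind := regvec_near_indep re ind_s.
  have /choice[c cE] : forall y, exists c : 'I_r -> k, indep (fun i => e i y) ->
      vB y = \sum_i c i *: e i y.
    move=> y; have [iy|] := pselect (indep (fun i => e i y)); last by exists (fun=> 0).
    have [||c cE] := indep_span (w := vB y) iy _ (rank_point_map rankM (incl y)).
    - by move=> i; rewrite memv_img// memvf.
    - by apply: memv_suml => i _; rewrite memvZ// limg_incl.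
    by exists c.
  exists r, (fun i y => c y i), (fun i y => image_section (s i) (incl y)); split.
    move=> i; split; last by exists (image_section (s i)) => //;
      apply: reg_image_section (near_pt_self (rs i)).
    move: i; apply: (regular_coords re rvB ind_s).
    by apply: near_ptS near_ind => y /cE.
  apply: near_ptS near_ind => y /cE vy; apply: subvs_inj; rewrite frame_mapE.
  rewrite -/(vB y) vy linear_sum; apply: eq_bigr => i _; rewrite linearZ.
  exact: (congr1 ( *:%R (c y i)) (esym (vsval_image_section _ _))).
Qed.

End LineSplitting.

(** * Comparison of the splitting type with the degree of det E_M *)

Section SplittingDegree.
Variables (k : closedFieldType) (A B : vectType k) (M : {vspace 'Hom(A, B)}) (r m : nat).
Hypothesis rankM : constant_rank M r.
Hypothesis dimB : \dim {:B} = (r + m)%N.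
Variable L : {vspace subvs_of M}.
Hypothesis dimL : \dim L = 2.
Local Notation V := (subvs_of M).
Local Notation W := (subvs_of L).
Local Notation incl := (@pspace_incl k (subvs_of M) L).
Implicit Types (x y : pspace W).
Variables (p : nat) (a : nat -> A) (b : nat -> B).
Hypothesis p_le : (p <= r)%N.
Local Notation frame := (@line_frame k A B M L p a b).
Hypothesis frame_indep : forall y, indep (fun i : 'I_r => frame y i).
Hypothesis frame_limg : forall y i, frame y i \in limg (line_map y).
Variables (e : 'I_(r + m) -> B) (l : 'I_(r + m) -> 'Hom(B, k^o)).
Hypothesis eE : forall u, u = \sum_i l i u *: e i.
Variables (d : nat) (w : {ffun 'I_m -> 'I_(r + m)} -> {mpoly k[\dim {:V}]}).
Variable nu : pspace V -> k.
Hypothesis w_homog : forall J, w J \is d.-homog.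
Hypothesis nu_neq0 : forall y : pspace V, nu y != 0.
Hypothesis nuE : forall (y : pspace V) J,
  \det (select_mx k J *m quot_mx rankM dimB e y) = nu y * form_at (w J) y.

Lemma sum_twist_degrees : \sum_(i < r + m) (if (i < p)%N then 1 else 0 : int) = p%:Z.
Proof.
rewrite -big_mkcond (big_ord_narrow (leq_trans p_le (leq_addr m r))).
by rewrite sumr_const card_ord natz.
Qed.

Lemma splitting_degree : p = d.
Proof.
have /choice[w' w'E] : forall J, exists w' : {mpoly k[\dim {:W}]}, w' \is d.-homog /\
    forall v, eval_form w' v = eval_form (w J) (vsval v).
  by move=> J; have [w' hw' E] := pullback_form L (w_homog J); exists w'.
pose minor J y := \det (col_mx (coord_mx l (fun i : 'I_r => frame y i)) (select_mx k J)).
have minorE y : exists c, c != 0 /\ forall J, minor J y = c * form_at (w' J) y.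
  have limgE i : frame y i \in limg (point_map (incl y)) by rewrite limg_incl.
  have [mu mu0 muE] := minor_quot_mx rankM dimB eE (frame_indep (y := y)) (fun i =>
    limgE i).
  have [c c0 cE] := rep_incl y.
  exists (mu^-1 * nu (incl y) * c ^+ d).
  split=> [|J]; first by rewrite !mulf_neq0 ?invr_eq0// expf_neq0.
  apply: (mulfI mu0); rewrite /minor muE nuE form_atE cE (eval_formZ _ _ (w_homog J)).
  by rewrite form_atE (w'E J).2 -!mulrA mulVKf.
(* Although built from arbitrary scalars, [phi] is the common ratio of the minors of the frame to
   the restricted w_J; dividing by a w_J that is nonzero at x shows it regular of degree p - d. *)
have /choice[phi phiE] := minorE.
suff : p%:Z - d%:Z = 0 by clear; lia.
apply: (@nonvanishing_regular_degree _ _ _ phi); first by rewrite (line_dim2 dimL).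
  move=> x; have [J wJ] : exists J, form_at (w' J) x != 0.
    have [J] := quot_mx_minor_neq0 rankM dimB eE (incl x);
      rewrite nuE mulf_eq0 negb_or => /andP[_ wJ].
    by exists J; rewrite (pullback_form_neq0 _ (w_homog J) (w'E J).2).
  have rw := regular_form x (w'E J).1.
  have rm : regular p%:Z (minor J) x.
    rewrite -sum_twist_degrees; apply: regular_det_rows => i j.
    case: (split_ordP i) => i' ->.
      have -> : (if (lshift m i' < p)%N then 1 else 0 : int) = - twist p i'.
        by rewrite /twist /=; case: ltnP.
      apply: regular_ext (regvec_line_frame p a b i' x (l j)) => y.
      by rewrite col_mxEu mxE.
    have -> : (if (rshift r i' < p)%N then 1 else 0 : int) = 0.
      by rewrite ltnNge /= (leq_trans p_le) ?leq_addr.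
    by apply: regular_ext (regular_cst (J i' == j)%:R x) => y; rewrite col_mxEd mxE.
  apply: regular_eq (regularM rm (regularV rw wJ)).
  apply: near_ptS (regular_neq0 rw wJ) => y wy.
  by rewrite (phiE y).2 mulfK.
by move=> y; apply: (phiE y).1.
Qed.

End SplittingDegree.

Theorem lemma2 (k : closedFieldType) (k_char0 : [pchar k] =i pred0)
    (A B : vectType k) (a b : nat) (dimA : \dim {:A} = a) (dimB : \dim {:B} = b)
    (M : {vspace 'Hom(A, B)}) (r n : nat) (rankM : constant_rank M r)
    (dimM : \dim M = n.+1) (n_ge1 : (1 <= n)%N) :
  let c := c1 (coker_bundle M) in
  [/\ 0 <= c, c <= r%:Z &
      uniform (image_bundle M) (nseq `|c|%N (-1) ++ nseq (r - `|c|%N) 0)].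
Proof.
have dimV : \dim {:subvs_of M} = n.+1 by rewrite dimvf.
have [y0 _] : exists y : pspace (subvs_of M), True.
  have : vpick {:subvs_of M} != 0 by rewrite vpick0 -dimv_eq0 dimV.
  by case/pspace_pt => y _; exists y.
have r_le : (r <= \dim {:B})%N by rewrite -(rank_point_map rankM y0) dimvS ?subvf.
(* [rep y0] is a nonzero map, so its image is nonzero; hence the forms N_IJ have positive degree. *)
have r_gt0 : (0 < r)%N.
  rewrite -(rank_point_map rankM y0) lt0n dimv_eq0; apply: contraNneq (rep_neq0 y0) => im0.
  apply/eqP/val_inj/lfunP => v; apply/eqP; rewrite zero_lfunE -memv0 -im0.
  by rewrite memv_img ?memvf.
have dimB' : \dim {:B} = (r + (\dim {:B} - r))%N by rewrite subnKC.
have [e [l [le eE]]] := dual_basis dimB'.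
have [d [w [dr hw nuE]]] := pluecker_forms rankM dimB' eE r_gt0 y0.
have /choice[nu nu_spec] : forall y : pspace (subvs_of M), exists c, c != 0 /\
    forall J, \det (select_mx k J *m quot_mx rankM dimB' e y) = c * form_at (w J) y.
  by move=> y; have [c c0 E] := nuE y; exists c.
have iso := det_coker_iso le eE hw (fun y => (nu_spec y).1) (fun y => (nu_spec y).2).
have c1E : c1 (coker_bundle M) = d%:Z by apply: c1_eq => //; rewrite dimV.
(* By d <= r the truncated subtraction r - d is exact, and the splitting type has length r. *)
rewrite /= c1E absz_nat; split=> //; split; first by rewrite (size_twists dr);
  apply: vector_bundle_image.
move=> L dimL; have [p [a' [b' [pr frameE]]]] := line_splitting rankM dimL.
have <- : p = d.
  exact: (splitting_degree dimL pr (fun y => (frameE y).1) (fun y => (frameE y).2) eE hw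
    (fun y => (nu_spec y).1) (fun y => (nu_spec y).2)).
exact: (restriction_iso rankM pr (fun y => (frameE y).1) (fun y => (frameE y).2)).
Qed.
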